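(* Let $(\Omega,\mathcal A,P)$ be a complete probability space, $I\subset\mathbb R$ an open interval (finite or infinite), $g\in L^1(I)$, and let $\varphi\colon I\times\Omega\to I$ satisfy conditions (a), (b), (c) listed in the context. Assume that $P(\Omega_+)=1$, that $$\int_\Omega|\varphi(x,\omega)-x|\,P(d\omega)<+\infty\quad\text{for every }x\in I,$$ and that there is $l\in(0,1)$ with $$\int_\Omega|\varphi(x,\omega)-\varphi(y,\omega)|\,P(d\omega)\le l|x-y|\quad\text{for all }x,y\in I.$$ Let $D$ be the probability distribution function defined in the context. If $$\int_I g(t)(1-D(t))\,dt=0$$ and if there exists $L\in(0,+\infty)$ such that $$\left|\int_x^y g(t)\,dt\right|\le L|x-y|\quad\text{for all }x,y\in I,$$ then there exists an absolutely continuous function $F\colon I\to\mathbb R$ satisfying, for every $x\in I$, $$F(x)=\int_{\Omega_+}F(\varphi(x,\omega))\,P(d\omega)+\int_{\Omega_-}[\alpha-F(\varphi(x,\omega))]\,P(d\omega)+\int_{\inf I}^x g(t)\,dt \qquad( * )$$ (here $P(\Omega_-)=0$, so the second integral vanishes and the value of the real constant $\alpha$ is irrelevant). Moreover, if for such an absolutely continuous solution $F$ of $( * )$ there exists $f\in L^1(I)$ with $F(x)=\int_{\inf I}^x f(t)\,dt$ for every $x\in I$, then $f$ is an $L^1(I)$-solution of the equation $$f(x)=\int_\Omega|\varphi'_x(x,\omega)|f(\varphi(x,\omega))\,P(d\omega)+g(x).$$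
   Context: Conditions on $\varphi$: (a) $\varphi(\cdot,\omega)$ is a diffeomorphism from $I$ onto $I$ for every $\omega\in\Omega$; (b) $\varphi(x,\cdot)$ is $\mathcal A$-measurable for every $x\in I$; (c) $(\lambda\otimes P)(\varphi^{-1}(B))=0$ for every Borel set $B\subset I$ with $\lambda(B)=0$, where $\lambda$ is Lebesgue measure. $\varphi'_x$ denotes the derivative with respect to the first variable. $\Omega_+=\{\omega\in\Omega:\varphi'_x(x_0,\omega)>0\}$ and $\Omega_-=\{\omega\in\Omega:\varphi'_x(x_0,\omega)<0\}$ for a fixed $x_0\in I$; by (a) these sets do not depend on $x_0$ and $\Omega=\Omega_+\cup\Omega_-$. A function $f\in L^1(I)$ is an $L^1(I)$-solution of the equation if every representative of $f$ satisfies it for Lebesgue-almost all $x\in I$. Definition of $D$. Under the contraction hypothesis (with constant $l<1$) and (a), the interval $I$ is unbounded, and if $I$ has a finite endpoint $e$, then $\lim_{y\to e}\varphi(y,\omega)\in\mathbb R$ for almost all $\omega$; discarding a null set of $\omega$'s, this is assumed for all $\omega\in\Omega$. Let $\mathrm{cl}\,I$ be the closure of $I$ in $\mathbb R$ and define $\varphi_0\colon\mathrm{cl}\,I\times\Omega\to\mathrm{cl}\,I$ by $\varphi_0(x,\omega)=\varphi(x,\omega)$ for $x\in I$ and $\varphi_0(x,\omega)=\lim_{y\to x}\varphi(y,\omega)$ for $x\in\mathrm{cl}\,I\setminus I$. The iterates are defined for $x\in\mathrm{cl}\,I$ and $\varpi=(\omega_1,\omega_2,\dots)\in\Omega^\infty$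 by $\varphi_0^1(x,\varpi)=\varphi_0(x,\omega_1)$ and $\varphi_0^{n+1}(x,\varpi)=\varphi_0(\varphi_0^n(x,\varpi),\omega_{n+1})$. Let $P^\infty$ be the product probability on $\Omega^\infty$ and let $\pi_n(x,B)=P^\infty(\{\varpi\in\Omega^\infty:\varphi_0^n(x,\varpi)\in B\})$ for Borel sets $B\subset\mathrm{cl}\,I$. It is known that, under the two integral hypotheses on $\varphi$ in the claim, there is a probability distribution $\pi$ on $\mathrm{cl}\,I$ such that for every $x\in\mathrm{cl}\,I$ the sequence $(\pi_n(x,\cdot))_{n\in\mathbb N}$ converges weakly to $\pi$. Then $D(t)=\pi([\inf I,t]\cap\mathbb R)$ for $t\in\mathrm{cl}\,I$. *)

(* Defs.v *)
From HB Require Import structures.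
From mathcomp Require Import all_boot all_order all_algebra.
From mathcomp Require Import all_classical all_reals all_analysis.

Set Implicit Arguments.
Unset Strict Implicit.
Unset Printing Implicit Defensive.

Import Order.TTheory GRing.Theory Num.Theory.
Import numFieldNormedType.Exports.
Local Open Scope classical_set_scope.
Local Open Scope ring_scope.

(* Functions on I are total functions on R; their values outside I play no
   role.  The underlying sigma-algebra on R is the Borel one, so an element of
   L^1(I) is given by a Borel representative integrable on I. *)

(* No continuity of the derivatives is required. *)
Definition diffeomorphism_onto (R : realType) (I : set R) (f : R -> R) : Prop :=
  set_bij I I f /\
  exists finv : R -> R,
    (forall x, I x -> finv (f x) = x) /\
    (forall x, I x -> derivable f x 1 /\ derivable finv x 1).

Definition abs_continuous_on (R : realType) (I : set R) (F : R -> R) : Prop :=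
  forall e : R, 0 < e -> exists2 delta : R, 0 < delta &
    forall (n : nat) (a b : 'I_n -> R),
      (forall i, [/\ I (a i), I (b i) & a i < b i]) ->
      trivIset [set: 'I_n] (fun i => `]a i, b i[%classic) ->
      \sum_(i < n) (b i - a i) < delta ->
      \sum_(i < n) `|F (b i) - F (a i)| < e.

(* The integral from x to y with orientation: one of the two terms is always an
   integral over the empty set or a point. *)
Definition oriented_integral (R : realType) (g : R -> R) (x y : R) : R :=
  \int[@lebesgue_measure R]_(t in `[x, y]) g t -
  \int[@lebesgue_measure R]_(t in `[y, x]) g t.

(* The integral from inf I to x. *)
Definition integral_from_inf (R : realType) (I : set R) (g : R -> R) (x : R)
    : R :=
  \int[@lebesgue_measure R]_(t in [set t | I t /\ t <= x]) g t.

Section random_map.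
Context (R : realType) (d : measure_display) (Omega : measurableType d).
Variables (P : probability Omega R) (I : set R) (phi : R -> Omega -> R).

Definition dphi (x : R) (w : Omega) : R := derive1 (phi ^~ w) x.

Definition nonsingular : Prop :=
  forall B : set (measurableTypeR R), measurable B -> B `<=` I ->
    lebesgue_measure B = 0%E ->
    (@lebesgue_measure R \x P)%E
      [set z : measurableTypeR R * Omega | I z.1 /\ B (phi z.1 z.2)] = 0%E.

Definition Omega_plus (x0 : R) : set Omega := [set w | 0 < dphi x0 w].
Definition Omega_minus (x0 : R) : set Omega := [set w | dphi x0 w < 0].

(* The extension of phi to the closure of I.  When P (Omega_plus x0) = 1, the
   limit at a finite endpoint x of I exists for almost all w; on the exceptional
   null set, which would otherwise have to be discarded, the value is set to x
   so that the extension maps the closure of I into itself for every w. *)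
Definition phi0 (x : R) (w : Omega) : R :=
  if x \in I then phi x w
  else if `[< cvg (phi y w @[y --> within I (nbhs x)]) >]
       then lim (phi y w @[y --> within I (nbhs x)])
       else x.

(* The sequence of parameters is indexed from 0. *)
Fixpoint phi0_iter (n : nat) (x : R) (w : nat -> Omega) : R :=
  if n is m.+1 then phi0 (phi0_iter m x w) (w m) else x.

(* The product sigma-algebra on sequences is generated by the coordinates. *)
Definition Omega_seq : Type :=
  g_sigma_algebraType (\bigcup_n preimage_set_system [set: nat -> Omega]
    (fun w => w n) (@measurable d Omega)).
HB.instance Definition _ := Measurable.on Omega_seq.

(* The product probability is the unique probability on the product
   sigma-algebra with the prescribed values on finite-dimensional rectangles. *)
Definition is_product_probability (Pinf : probability Omega_seq R) : Prop :=
  forall (n : nat) (A : nat -> set Omega), (forall i, measurable (A i)) ->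
    Pinf [set w : Omega_seq | forall i, (i < n)%N -> A i (w i)] =
    (\prod_(i < n) P (A i))%E.

Definition iter_law (Pinf : probability Omega_seq R) (n : nat) (x : R)
    : set (measurableTypeR R) -> \bar R :=
  pushforward Pinf (phi0_iter n x : Omega_seq -> measurableTypeR R).

Definition weakly_converges_on (C : set R)
    (mu_ : nat -> set (measurableTypeR R) -> \bar R)
    (mu : set (measurableTypeR R) -> \bar R) : Prop :=
  forall h : R -> R, {within C, continuous h} ->
    (exists M : R, forall y, C y -> `|h y| <= M) ->
    (\int[mu_ n]_(y in C) (h y)%:E)%E @[n --> \oo] -->
    (\int[mu]_(y in C) (h y)%:E)%E.

Definition limit_distribution (Pinf : probability Omega_seq R)
    (nu : probability (measurableTypeR R) R) : Prop :=
  nu (closure I) = 1%E /\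
  forall x, closure I x ->
    weakly_converges_on (closure I) (fun n => iter_law Pinf n x) nu.

Definition distribution_function (nu : probability (measurableTypeR R) R)
    (t : R) : R :=
  fine (nu [set s | (ereal_inf [set x%:E | x in I] <= s%:E)%E /\ s <= t]).

Definition integrated_solution (x0 alpha : R) (g F : R -> R) : Prop :=
  forall x, I x ->
    [/\ P.-integrable (Omega_plus x0) (fun w => (F (phi x w))%:E),
        P.-integrable (Omega_minus x0) (fun w => (alpha - F (phi x w))%:E) &
        F x = \int[P]_(w in Omega_plus x0) F (phi x w)
              + \int[P]_(w in Omega_minus x0) (alpha - F (phi x w))
              + integral_from_inf I g x].

(* A function equal almost everywhere on I to f need not be Borel: h ranges
   over all Lebesgue representatives of f. *)
Definition L1_solution (g f : R -> R) : Prop :=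
  forall h : R -> R,
    {ae @lebesgue_measure R, forall x, I x -> h x = f x} ->
    {ae @lebesgue_measure R, forall x, I x ->
      P.-integrable setT (fun w => (`|dphi x w| * h (phi x w))%:E) /\
      h x = \int[P]_w (`|dphi x w| * h (phi x w)) + g x}.

End random_map.

(* Main.v *)
From HB Require Import structures.
Require Import Defs.
From mathcomp Require Import all_boot all_order all_algebra.
From mathcomp Require Import all_classical all_reals all_analysis.
From mathcomp Require Import measurable_realfun ring lra.
Set Implicit Arguments.
Unset Strict Implicit.
Unset Printing Implicit Defensive.
Import Order.TTheory GRing.Theory Num.Theory.
Import numFieldNormedType.Exports.
Local Open Scope classical_set_scope.
Local Open Scope ring_scope.

(** Let [G x] be the integral of [g] from [inf I] to [x], and let [T] be the
    transition operator [T u x = E u (phi x .)].  As [Omega_plus] has full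
    probability, the integrated equation reads [F = T F + G], and its solution
    is the Neumann series [F = \sum_n T^n G].

    Convergence.  By the contraction hypothesis [T] multiplies Lipschitz
    constants by at most [l] ([transition_lipschitz]), so [T^n G] is Lipschitz
    with constant [L * l ^+ n].  At the points [x] and [phi x w] this bounds
    [T^(n+1) G x - T^n G x] by [L * l ^+ n * E `|phi x . - x|]
    ([iterate_drift]).  Hence [T^n G x]
    converges geometrically, and only its limit matters.  If [X_n] denotes the
    [n]-th iterate started at [x], then [T^n G x = E (G X_n)], because the
    parameter of index [n] is independent of [X_n] ([integral_phi0_iterS]).
    Weak convergence of the laws of [X_n] to [nu], together with Fubini
    ([integral_primitive_nu]), gives
    [T^n G x --> \int G dnu = \int_I g (1 - D) = 0].
    So the series is dominated by a geometric one ([iterate_geometric]) and its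
    sum is Lipschitz with constant [L / (1 - l)], in particular absolutely
    continuous ([neumann_lipschitz], [neumann_fixpoint]).

    The density.  Let [F] be the primitive of [f].  An increasing map [p] of
    [I] onto [I] which is differentiable everywhere, as is its inverse,
    satisfies [\int_I (f \o p) p' = \int_I f], even when [p'] is not
    continuous ([integral_comp_derive]).  Applied to [phi ^~ w] and integrated
    over [w], this turns [E F (phi x .)] into the primitive of
    [transfer x = E `|dphi x .| f (phi x .)] ([integral_from_inf_transfer]).
    So [f - transfer - g] has integral zero up to every [x] in [I], and it
    vanishes almost everywhere by Lebesgue differentiation
    ([ae_eq0_of_integral_eq0]).  Another representative of [f] differs from [f]
    on a null set, which by nonsingularity is almost surely avoided by [phi x]
    for almost every [x] ([ae_comp_phi]); completeness of [P] makes the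
    modified integrand measurable. *)

(** * Integrability and measurability facts *)

Lemma integrable_EFinB (R : realType) (d : measure_display)
    (T : measurableType d) (m : {measure set T -> \bar R}) (D : set T)
    (f g : T -> R) : measurable D ->
  m.-integrable D (EFin \o f) -> m.-integrable D (EFin \o g) ->
  m.-integrable D (EFin \o (fun x => f x - g x)).
Proof. by move=> mD if_ ig; exact: (integrableB mD if_ ig). Qed.

Lemma bounded_integrable (R : realType) (d : measure_display)
    (T : measurableType d) (m : {measure set T -> \bar R}) (f : T -> R) (M : R) :
  (m setT < +oo)%E -> measurable_fun setT f -> (forall x, `|f x| <= M) ->
  m.-integrable setT (EFin \o f).
Proof.
move=> mT mf fM; apply: measurable_bounded_integrable => //.
exists M; split; first exact: num_real.
by move=> y My x _; exact: le_trans (fM x) (ltW My).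
Qed.

Lemma measurable_setI_le (R : realType) (I : set R) (x : R) :
  measurable I -> measurable [set t | I t /\ t <= x].
Proof.
move=> mI; rewrite (_ : [set t | _] = I `&` `]-oo, x]).
  by apply: measurableI => //; exact: measurable_itv.
by apply/seteqP; split => t /=; rewrite in_itv.
Qed.

(** * Increasing differentiable maps and change of variables *)

Lemma lebesgue_measure_le_diam (R : realType) (B : set R) (r : R) :
  measurable B -> 0 <= r -> (forall x y, B x -> B y -> y - x <= r) ->
  (@lebesgue_measure R B <= r%:E)%E.
Proof.
move=> mB r0 Br; have [->|/set0P[x0 Bx0]] := eqVneq B set0.
  by rewrite measure0 lee_fin.
have hiB : has_inf B.
  by split; [exists x0|exists (x0 - r) => y By; rewrite lerBlDr -lerBlDl Br].
have BI : B `<=` `[inf B, inf B + r].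
  move=> y By /=; rewrite in_itv/=; apply/andP; split;
    first exact: (ge_inf hiB.2).
  rewrite -lerBlDr; apply: lb_le_inf; first by exists x0.
  by move=> x Bx; rewrite lerBlDr -lerBlDl Br.
apply: (@le_trans _ _ (@lebesgue_measure R `[inf B, inf B + r]%classic)).
  by rewrite le_measure ?inE//; exact: measurable_itv.
rewrite lebesgue_measure_itv/= lte_fin; case: ifPn => _;
  last by rewrite lee_fin.
by rewrite -EFinD lee_fin addrAC subrr add0r.
Qed.

(** Derivatives are computed along the increments [- n.+1%:R^-1], so that every
    limit involving them is a limit of a sequence of measurable functions. *)
Lemma cvg_sub_harmonic (R : realType) (x : R) :
  x - n.+1%:R^-1 @[n --> \oo] --> x.
Proof.
rewrite -[X in _ --> X]subr0; apply: cvgB; first exact: cvg_cst.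
exact: (@cvg_harmonic R).
Qed.

Lemma derive1_left_quotient (R : realType) (f : R -> R) (x : R) :
  derivable f x 1 ->
  n.+1%:R * (f x - f (x - n.+1%:R^-1)) @[n --> \oo] --> derive1 f x.
Proof.
move=> df.
have : h^-1 *: (f (h + x) - f x) @[h --> 0^'] --> derive1 f x.
  apply: (cvg_toP _ _) => //.
  move: df; rewrite /derivable.
  by under eq_fun do rewrite [_ *: 1]mulr1.
move/cvgr_dnbhsP => h.
rewrite (_ : (fun n => _) = fun n => (- n.+1%:R^-1)^-1 *:
    (f (- n.+1%:R^-1 + x) - f x)); last first.
  by apply/funext => n;
    rewrite invrN invrK scaleNr -scalerN opprB [- _ + x]addrC.
apply: (h (fun n => - n.+1%:R^-1)); split; first by move=> n;
  rewrite oppr_eq0 gt_eqF.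
by rewrite -[X in _ --> X]oppr0; apply: cvgN; exact: (@cvg_harmonic R).
Qed.

Lemma derivable_continuous_at (R : realType) (f : R -> R) (x : R) :
  derivable f x 1 -> {for x, continuous f}.
Proof. by move=> /derivable1_diffP/differentiable_continuous. Qed.

Lemma derivable_measurable (R : realType) (I : set R) (f : R -> R) :
  open I -> (forall x, I x -> derivable f x 1) -> measurable_fun I f.
Proof.
move=> oI df; apply: open_continuous_measurable_fun => // x.
by rewrite inE => Ix; exact/derivable_continuous_at/df.
Qed.

Lemma measurable_ltr_set d (T : measurableType d) (R : realType) (f g : T -> R) :
  measurable_fun setT f -> measurable_fun setT g ->
  measurable [set x | f x < g x].
Proof.
move=> mf mg; rewrite -[X in measurable X]setTI.
by under eq_set do rewrite -lte_fin; apply: measurable_lte => //;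
  exact: measurableT_comp.
Qed.

Lemma measurable_ler_set d (T : measurableType d) (R : realType) (f g : T -> R) :
  measurable_fun setT f -> measurable_fun setT g ->
  measurable [set x | f x <= g x].
Proof.
move=> mf mg; rewrite -[X in measurable X]setTI.
by under eq_set do rewrite -lee_fin; apply: measurable_lee => //;
  exact: measurableT_comp.
Qed.

Lemma fatou_cvg d (T : measurableType d) (R : realType)
    (mu : {measure set T -> \bar R}) (D : set T)
    (f_ : nat -> T -> \bar R) (f : T -> \bar R) (c : \bar R) :
  measurable D -> (forall n, measurable_fun D (f_ n)) ->
  (forall n x, D x -> (0 <= f_ n x)%E) ->
  (forall x, D x -> f_ ^~ x @ \oo --> f x) ->
  (forall n, (\int[mu]_(x in D) f_ n x <= c)%E) ->
  (\int[mu]_(x in D) f x <= c)%E.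
Proof.
move=> mD mf f0 fcvg fc.
rewrite (eq_integral (fun x => limn_einf (f_ ^~ x))); last first.
  by move=> x; rewrite inE => Dx; have [-> _] := cvg_limn_einf_sup (fcvg _ Dx).
apply: (le_trans (fatou _ mD mf f0)); rewrite limn_einf_lim.
apply: lime_le; first exact: is_cvg_einfs.
by apply: nearW => n; apply: le_trans (fc n); apply: ereal_inf_lbound;
  exists n => /=.
Qed.

Section increasing_map.
Variables (R : realType) (I : set R) (f : R -> R).
Hypotheses (oI : open I) (df : forall x, I x -> derivable f x 1).
Hypothesis incf : forall x y, I x -> I y -> x < y -> f x < f y.
Notation mu := (@lebesgue_measure R).
Let mI : measurable I. Proof. exact: open_measurable. Qed.

Lemma near_sub_harmonic x : I x -> \forall n \near \oo, I (x - n.+1%:R^-1).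
Proof.
move=> Ix; have nI : nbhs x I by exact: open_nbhs_nbhs.
exact: (@cvg_sub_harmonic R x I nI).
Qed.

Lemma increasing_derive1_ge0 x : I x -> 0 <= derive1 f x.
Proof.
move=> Ix; apply: (cvgr_to_ge (derive1_left_quotient (df Ix))).
apply: filterS (near_sub_harmonic Ix) => n In.
by rewrite mulr_ge0// subr_ge0 ltW// incf// gtrBl.
Qed.

(** Tonelli on this set compares the growth of [f] with the measure of [U]: the
    section at [x] has measure about [d * f' x] if [f x] is in [U], and the
    section at a level [s] has diameter at most [d], as [f] crosses [s] only
    once. *)
Let strip (U : set R) (d : R) : set (R * R) :=
  [set z | [/\ I z.1, I (z.1 - d), (f \_ I) (z.1 - d) < z.2,
               z.2 <= (f \_ I) z.1 & U z.2]].

Let measurable_strip U d : measurable U -> measurable (strip U d).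
Proof.
move=> mU.
have mf : measurable_fun setT (f \_ I).
  by apply: (measurable_restrictT f mI).1; exact: derivable_measurable.
have mfst : measurable_fun setT (fst : R * R -> R) by exact: measurable_fst.
have msnd : measurable_fun setT (snd : R * R -> R) by exact: measurable_snd.
have mfd : measurable_fun setT (fun z : R * R => z.1 - d).
  by apply: measurable_funB.
have -> : strip U d = (fst @^-1` I) `&` ((fun z => z.1 - d) @^-1` I) `&`
    [set z | (f \_ I) (z.1 - d) < z.2] `&` [set z | z.2 <= (f \_ I) z.1] `&`
    (snd @^-1` U).
  by apply/seteqP; split=> [z [? ? ? ? ?]|z [[[[? ?] ?] ?] ?]].
do 4 (try apply: measurableI).
- by rewrite -[X in measurable X]setTI; apply: mfst.
- by rewrite -[X in measurable X]setTI; exact: mfd.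
- by apply: measurable_ltr_set => //; exact: measurableT_comp mf _.
- by apply: measurable_ler_set => //; exact: measurableT_comp mf _.
- by rewrite -[X in measurable X]setTI; exact: msnd.
Qed.

Let ysection_strip U (d : R) s : measurable U -> 0 < d ->
  (mu (ysection (strip U d) s) <= (d * \1_U s)%:E)%E.
Proof.
move=> mU d0; have [Us|nUs] := pselect (U s); last first.
  rewrite indicE memNset// mulr0 [X in mu X](_ : _ = set0) ?measure0//.
  by apply/seteqP; split => // x; rewrite /ysection/= inE => -[].
rewrite indicE mem_set// mulr1; apply: lebesgue_measure_le_diam => //.
- by apply: measurable_ysection; exact: measurable_strip.
- exact: ltW.
move=> x y; rewrite /ysection/= !inE => -[/= Ix Ixd _ + _] [/= Iy Iyd + _ _].
rewrite !patchE !mem_set//= => sx sy.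
rewrite leNgt; apply/negP; rewrite ltrBrDl -ltrBrDr => /(incf Ix Iyd).
by rewrite ltNge => /negP; apply; exact/ltW/(lt_le_trans sy).
Qed.

Let integral_strip U n : measurable U ->
  (\int[mu]_x (n.+1%:R%:E * mu (xsection (strip U n.+1%:R^-1) x)) <= mu U)%E.
Proof.
move=> mU; have mS := measurable_strip n.+1%:R^-1 mU.
rewrite ge0_integralZl//; last exact: measurable_fun_xsection.
have -> : (\int[mu]_x mu (xsection (strip U n.+1%:R^-1) x) =
    \int[mu]_y mu (ysection (strip U n.+1%:R^-1) y))%E.
  have := @indic_fubini_tonelli _ _ _ _ R mu mu _ mS.
  by rewrite indic_fubini_tonelli_FE// indic_fubini_tonelli_GE.
rewrite muleC -lee_pdivlMr// -?EFinV//.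
apply: (@le_trans _ _ (\int[mu]_y ((n.+1%:R^-1)%:E * (\1_U y)%:E)))%E.
  apply: ge0_le_integral => //.
  - exact: measurable_fun_ysection.
  - by apply: measurable_funeM; exact/measurable_EFinP.
  - by move=> y _; rewrite -EFinM ysection_strip.
rewrite ge0_integralZl//; last by apply/measurable_EFinP;
  exact: measurable_indic.
by rewrite integral_indic// setIT muleC.
Qed.

(** As [U] is a neighbourhood of [f x], the levels crossed between
    [x - n.+1%:R^-1] and [x] all lie in [U] for large [n], and the section is an
    interval. *)
Let cvg_strip U x : open U -> I x -> U (f x) ->
  (n.+1%:R%:E * mu (xsection (strip U n.+1%:R^-1) x))%E @[n --> \oo] -->
  (derive1 f x)%:E.
Proof.
move=> oU Ix Ux.
have : (n.+1%:R * (f x - f (x - n.+1%:R^-1)))%:E @[n --> \oo] -->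
    (derive1 f x)%:E.
  by apply: cvg_EFin; [exact: nearW|exact/derive1_left_quotient/df].
apply: cvg_trans; apply: near_eq_cvg.
have [e /= e0 eU] : \forall y \near f x, U y by exact: open_nbhs_nbhs.
have fc := derivable_continuous_at (df Ix).
have : \forall n \near \oo, f x - e < f (x - n.+1%:R^-1).
  have := cvg_comp _ _ (@cvg_sub_harmonic R x) fc.
  by move=> /(cvgr_gt (f x)); apply; rewrite gtrBl.
move=> near_f; near=> n.
have In : I (x - n.+1%:R^-1) by near: n; exact: near_sub_harmonic.
have fn : f x - e < f (x - n.+1%:R^-1) by near: n.
have xn : f (x - n.+1%:R^-1) < f x by apply: incf => //; rewrite gtrBl.
rewrite EFinM; congr (_ * _)%E.
have -> : xsection (strip U n.+1%:R^-1) x = `]f (x - n.+1%:R^-1), f x]%classic.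
  apply/seteqP; split => s; rewrite /xsection/= inE /strip/= !patchE !mem_set//.
    by case=> _ _ s1 s2 _; rewrite in_itv/= s1.
  rewrite in_itv/= => /andP[s1 s2]; split => //.
  apply: eU; rewrite /= ger0_norm ?subr_ge0//.
  by rewrite ltrBlDr -ltrBlDl (lt_trans fn).
by rewrite lebesgue_measure_itv/= lte_fin xn EFinB.
Unshelve. all: by end_near. Qed.

(** Fatou applied to the rescaled sections of [strip].  Only an inequality
    results: an increasing function which is merely differentiable almost
    everywhere can satisfy it strictly. *)
Lemma le_integral_derive_open (U : set R) : open U ->
  (\int[mu]_(x in I `&` f @^-1` U) (derive1 f x)%:E <= mu U)%E.
Proof.
move=> oU; have mU : measurable U by exact: open_measurable.
have mE : measurable (I `&` f @^-1` U) by exact: (derivable_measurable oI df).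
apply: (@fatou_cvg _ (measurableTypeR R) R mu (I `&` f @^-1` U)
  (fun n x => n.+1%:R%:E * mu (xsection (strip U n.+1%:R^-1) x))%E) => //.
- move=> n; apply: measurable_funTS. apply: measurable_funeM.
  by apply: measurable_fun_xsection; exact: measurable_strip.
- by move=> n x _; rewrite mule_ge0.
- by move=> x [Ix Ux]; exact: cvg_strip.
- move=> n; apply: le_trans (integral_strip n mU).
  apply: ge0_subset_integral => //; last by move=> x _; rewrite mule_ge0.
  apply: measurable_funeM.
  by apply: measurable_fun_xsection; exact: measurable_strip.
Qed.

Lemma measurable_derive1 : measurable_fun I (derive1 f).
Proof.
have mf : measurable_fun setT (f \_ I).
  by apply: (measurable_restrictT f mI).1; exact: derivable_measurable.
apply: (@measurable_fun_cvg _ _ _ _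
  (fun n x => n.+1%:R * ((f \_ I) x - (f \_ I) (x - n.+1%:R^-1)))) => //.
- move=> n; apply: measurable_funTS; apply: measurable_funM => //.
  apply: measurable_funB => //; apply: measurableT_comp mf _.
  exact: measurable_funB.
- move=> x Ix; have := derive1_left_quotient (df Ix).
  apply: cvg_trans; apply: near_eq_cvg.
  apply: filterS (near_sub_harmonic Ix) => n In.
  by rewrite !patchE !mem_set.
Qed.

(** From open to Borel sets by outer regularity of Lebesgue measure. *)
Lemma le_integral_derive_preimage (A : set R) : measurable A ->
  (\int[mu]_(x in I `&` f @^-1` A) (derive1 f x)%:E <= mu A)%E.
Proof.
move=> mA; have [muA|] := ltP (mu A) +oo%E; last first.
  by rewrite leye_eq => /eqP ->; rewrite leey.
apply/lee_addgt0Pr => e e0.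
have [U [oU AU UA]] := lebesgue_regularity_outer mA muA e0.
have mU : measurable U by exact: open_measurable.
apply: (@le_trans _ _ (\int[mu]_(x in I `&` f @^-1` U) (derive1 f x)%:E)%E).
  apply: ge0_subset_integral => //.
  - exact: (derivable_measurable oI df).
  - exact: (derivable_measurable oI df).
  - apply/measurable_EFinP; apply: measurable_funS measurable_derive1 => //.
  - by move=> x [Ix _]; rewrite lee_fin increasing_derive1_ge0.
  - by move=> x [Ix Ax]; split => //; exact: AU.
apply: (le_trans (le_integral_derive_open oU)).
rewrite -[X in mu X](setDUK AU) measureU//; [|exact: measurableD|].
  by apply: leeD => //; exact: ltW.
by rewrite setDIK.
Qed.

End increasing_map.

Section increasing_map_integral.
Variables (R : realType) (I : set R) (f : R -> R).
Hypotheses (oI : open I) (df : forall x, I x -> derivable f x 1).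
Hypothesis incf : forall x y, I x -> I y -> x < y -> f x < f y.
Notation mu := (@lebesgue_measure R).
Let mI : measurable I. Proof. exact: open_measurable. Qed.
Import HBNNSimple.

Let le_integral_comp_nnsfun (g : {nnsfun (measurableTypeR R) >-> R}) :
  (\int[mu]_(x in I) (g (f x) * derive1 f x)%:E <= \int[mu]_y (g y)%:E)%E.
Proof.
have mf := derivable_measurable oI df.
have mf' := measurable_derive1 oI df.
have f'0 := increasing_derive1_ge0 oI df incf.
have mg : measurable_fun setT (g : measurableTypeR R -> R) by [].
have mgk k : measurable (g @^-1` [set k]).
  by have := mg measurableT [set k]; rewrite setTI; apply.
rewrite integralT_nnsfun sintegralE.
pose e k x := ((k * \1_(g @^-1` [set k]) (f x))%:E * (derive1 f x)%:E)%E.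
have fin_g : finite_set (range g) by exact: fimfunP.
have ind0 k y : 0 <= k * \1_(g @^-1` [set k]) y.
  by rewrite indicE; case: (boolP (_ \in _)) => [/set_mem <-|_];
    rewrite ?mulr1 ?mulr0.
have e0 k x : I x -> (0 <= e k x)%E.
  by move=> Ix; rewrite /e mule_ge0// ?lee_fin ?f'0.
have mind k : measurable_fun I (fun x => \1_(g @^-1` [set k]) (f x) : R).
  have h : measurable_fun setT (\1_(g @^-1` [set k]) : measurableTypeR R -> R) by exact: measurable_indic (mgk k).
  exact: measurableT_comp h mf.
have -> : (\int[mu]_(x in I) (g (f x) * derive1 f x)%:E =
    \int[mu]_(x in I) \sum_(k \in range g) e k x)%E.
  apply: eq_integral => x; rewrite inE => Ix; rewrite [in LHS](fimfunE g (f x)).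
  rewrite EFinM -fsumEFin// ge0_mule_fsuml// => k.
  by rewrite lee_fin ind0.
rewrite ge0_integral_fsum//; last first.
  move=> k; apply/measurable_EFinP; apply: measurable_funM => //.
  apply: measurable_funM; [exact: measurable_cst|exact: mind].
apply: lee_fsum => // k [y _ gyk].
have k0 : 0 <= k by rewrite -gyk.
have -> : (\int[mu]_(x in I) e k x = \int[mu]_(x in I)
    (k%:E * (\1_(g @^-1` [set k]) (f x) * derive1 f x)%:E))%E.
  by apply: eq_integral => x _; rewrite /e -!EFinM mulrA.
rewrite ge0_integralZl//; last 2 first.
- by apply/measurable_EFinP; apply: measurable_funM => //; exact: mind.
- by move=> x Ix; rewrite lee_fin mulr_ge0// f'0.
apply: lee_wpmul2l => //;
  apply: le_trans (le_integral_derive_preimage oI df incf (mgk k)).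
rewrite integral_mkcondr le_eqVlt; apply/orP; left; apply/eqP.
apply: eq_integral => x _; rewrite patchE indicE.
have -> : (f x \in g @^-1` [set k]) = (x \in f @^-1` (g @^-1` [set k])).
  by apply/idP/idP; rewrite !inE.
by case: ifPn => _; rewrite ?mul1r ?mul0r.
Qed.

(** The measure inequality [le_integral_derive_preimage], passed from indicators
    to simple functions and then to nonnegative functions. *)
Lemma le_integral_comp_derive (h : R -> \bar R) :
  measurable_fun setT h -> (forall y, (0 <= h y)%E) ->
  (\int[mu]_(x in I) (h (f x) * (derive1 f x)%:E) <= \int[mu]_y h y)%E.
Proof.
move=> mh h0.
have mh' : measurable_fun [set: measurableTypeR R] (h : measurableTypeR R -> \bar R) by [].
pose g := nnsfun_approx measurableT mh'.
apply: (@fatou_cvg _ (measurableTypeR R) R mu I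
  (fun n x => (g n (f x) * derive1 f x)%:E)) => //.
- move=> n; apply/measurable_EFinP; apply: measurable_funM.
    have mgn : measurable_fun setT (g n : measurableTypeR R -> R) by [].
    exact: measurableT_comp mgn (derivable_measurable oI df).
  exact: measurable_derive1.
- by move=> n x Ix; rewrite lee_fin mulr_ge0// (increasing_derive1_ge0 oI df).
- move=> x Ix; under eq_fun do rewrite EFinM.
  by apply: cvgeZr => //; apply: cvg_nnsfun_approx.
- move=> n; apply: (le_trans (le_integral_comp_nnsfun _)).
  apply: ge0_le_integral => //.
  + by move=> x _; rewrite lee_fin.
  + exact/measurable_EFinP.
  + by move=> x _; rewrite /g nnsfun_approxE; exact: le_approx.
Qed.

End increasing_map_integral.

Section increasing_diffeomorphism.
Variables (R : realType) (I : set R) (f finv : R -> R).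
Hypotheses (oI : open I) (f_bij : set_bij I I f).
Hypothesis finvK : forall x, I x -> finv (f x) = x.
Hypotheses (df : forall x, I x -> derivable f x 1)
  (dfinv : forall x, I x -> derivable finv x 1).
Hypothesis incf : forall x y, I x -> I y -> x < y -> f x < f y.
Notation mu := (@lebesgue_measure R).
Let mI : measurable I. Proof. exact: open_measurable. Qed.
Let fI x : I x -> I (f x). Proof. by case: f_bij => fI _ _; exact: fI. Qed.

Let finvI y : I y -> I (finv y).
Proof. by case: f_bij => _ _ fS /fS[x Ix <-]; rewrite finvK. Qed.

Let fK y : I y -> f (finv y) = y.
Proof. by case: f_bij => _ _ fS /fS[x Ix <-]; rewrite finvK. Qed.

Let incfinv x y : I x -> I y -> x < y -> finv x < finv y.
Proof.
move=> Ix Iy xy; rewrite ltNge le_eqVlt; apply/negP => /orP[/eqP e|].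
  by move: xy; rewrite -(fK Ix) -(fK Iy) e ltxx.
by move=> /(incf (finvI Iy) (finvI Ix)); rewrite !fK// ltNge (ltW xy).
Qed.

Lemma derive1_inverse y : I y -> derive1 f (finv y) * derive1 finv y = 1.
Proof.
move=> Iy; rewrite -derive1_comp; [|exact: dfinv|exact/df/finvI].
rewrite derive1E (near_eq_derive (g := id)) ?derive_id//.
have nI : \forall z \near y, I z by exact: open_nbhs_nbhs.
by apply: filterS nI => z Iz; exact: fK.
Qed.

(** One inequality is [le_integral_comp_derive] for [f].  The converse is the
    same inequality for the inverse map and the integrand [(h \o f) * f'], which
    composed with the inverse and multiplied by its derivative gives [h] back,
    by [derive1_inverse].  Differentiability of the inverse replaces continuity
    of [f']. *)
Lemma integral_comp_derive (h : R -> \bar R) :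
  measurable_fun I h -> (forall y, I y -> (0 <= h y)%E) ->
  (\int[mu]_(x in I) (h (f x) * (derive1 f x)%:E) = \int[mu]_(y in I) h y)%E.
Proof.
move=> mh h0.
have f'0 := increasing_derive1_ge0 oI df incf.
have mhI : measurable_fun setT (h \_ I) by exact: (measurable_restrictT h mI).1.
have hI0 y : (0 <= (h \_ I) y)%E.
  by rewrite patchE; case: ifPn => // /set_mem; exact: h0.
have E1 : (\int[mu]_(x in I) (h (f x) * (derive1 f x)%:E) =
    \int[mu]_(x in I) ((h \_ I) (f x) * (derive1 f x)%:E))%E.
  by apply: eq_integral => x; rewrite inE => Ix; rewrite patchE mem_set//;
    exact: fI.
apply/eqP; rewrite eq_le; apply/andP; split.
  rewrite E1 [leRHS]integral_mkcond.
  exact: le_integral_comp_derive.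
(* composed with the inverse and multiplied by its derivative, H gives h back *)
pose H := (fun x => (h (f x) * (derive1 f x)%:E)%E) \_ I.
have mf := derivable_measurable oI df.
have mH : measurable_fun setT H.
  apply: (measurable_restrictT _ mI).1; apply: emeasurable_funM.
    have : measurable_fun I ((h \_ I) \o f) by exact: measurableT_comp mhI mf.
    apply: eq_measurable_fun => x; rewrite inE => Ix /=.
    by rewrite patchE mem_set//; exact: fI.
  by apply/measurable_EFinP; exact: measurable_derive1.
have H0 x : (0 <= H x)%E.
  rewrite /H patchE; case: ifPn => // /set_mem Ix.
  by rewrite mule_ge0 ?lee_fin ?f'0 ?h0//; exact: fI.
rewrite [leRHS]integral_mkcond.
apply: le_trans (le_integral_comp_derive oI dfinv incfinv mH H0).
rewrite le_eqVlt; apply/orP; left; apply/eqP.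
apply: eq_integral => y; rewrite inE => Iy.
rewrite /H patchE mem_set; last exact: finvI.
by rewrite fK// -muleA -EFinM derive1_inverse// mule1.
Qed.

Lemma integral_comp_derive_EFin (h : R -> R) :
  measurable_fun I h ->
  (\int[mu]_(x in I) (h (f x) * derive1 f x)%:E =
   \int[mu]_(y in I) (h y)%:E)%E.
Proof.
move=> mh.
have f'0 := increasing_derive1_ge0 oI df incf.
have mh' : measurable_fun I (EFin \o h) by exact/measurable_EFinP.
rewrite integralE [RHS]integralE; congr (_ - _)%E.
- rewrite -(integral_comp_derive (measurable_funepos mh'))//.
  apply: eq_integral => x; rewrite inE => Ix.
  by rewrite !funeposE EFinM muleC -{1}(mule0 (derive1 f x)%:E)
    -maxe_pMr ?lee_fin ?f'0// muleC.
- rewrite -(integral_comp_derive (measurable_funeneg mh'))//.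
  apply: eq_integral => x; rewrite inE => Ix.
  by rewrite !funenegE EFinM muleC -muleN -{1}(mule0 (derive1 f x)%:E)
    -maxe_pMr ?lee_fin ?f'0// muleC.
Qed.

End increasing_diffeomorphism.

(** A continuous injection on an interval is strictly monotone, and the sign of
    one derivative decides which way. *)
Lemma diffeomorphism_increasing (R : realType) (I : set R) (f : R -> R) (x0 : R) :
  is_interval I -> open I -> diffeomorphism_onto I f -> I x0 ->
  0 < derive1 f x0 -> forall x y, I x -> I y -> x < y -> f x < f y.
Proof.
move=> itvI oI [[_ finj _] [finv [_ dfI]]] Ix0 f'x0.
have df x : I x -> derivable f x 1 by move=> /dfI[].
have IE : I = [set` Rhull I] by exact/is_intervalP.
have fc : {within [set` Rhull I], continuous f}.
  rewrite -IE; apply: continuous_in_subspaceT => x.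
  by rewrite inE => Ix; exact/derivable_continuous_at/df.
have finj' : {in Rhull I &, injective f}.
  move=> x y xI yI; apply: finj; rewrite inE IE//.
have memI x : I x -> x \in Rhull I by rewrite {1}IE.
have [fmono x y Ix Iy xy|fmono] := itv_continuous_inj_mono fc finj'.
  by rewrite fmono ?memI.
exfalso; move: f'x0; apply/negP; rewrite -leNgt.
apply: (cvgr_to_le (derive1_left_quotient (df _ Ix0))).
apply: filterS (near_sub_harmonic oI Ix0) => n In.
by rewrite mulr_ge0_le0// subr_le0 ltW// fmono ?memI// gtrBl.
Qed.

(** * Primitives *)

(** The primitive of [u], extended by zero, is locally zero on [I]; at Lebesgue
    points its derivative is [u]. *)
Lemma ae_eq0_of_integral_eq0 (R : realType) (I : set R) (u : R -> R) :
  open I -> (@lebesgue_measure R).-integrable I (EFin \o u) ->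
  (forall x, I x -> integral_from_inf I u x = 0) ->
  {ae @lebesgue_measure R, forall x, I x -> u x = 0}.
Proof.
move=> oI iu u0; have mI := open_measurable oI.
have iv : (@lebesgue_measure R).-integrable setT (EFin \o (u \_ I)).
  by move: iu; rewrite integrable_mkcond//= restrict_EFin.
have locv : locally_integrable setT (u \_ I).
  exact: integrable_locally.
have ivy y : (@lebesgue_measure R).-integrable `]-oo, y]%classic (EFin \o (u \_ I)).
  exact: integrableS iv.
have := FTC1Ny ivy locv; apply: filterS.
  exact: (ae_filter_ringOfSetsType (@lebesgue_measure R)).
move=> x [dF F'] Ix.
move: F'; rewrite [RHS]patchE mem_set// => <-.
rewrite derive1E (near_eq_derive (g := cst 0)) ?derive_cst//.
have nI : \forall z \near x, I z by exact: open_nbhs_nbhs.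
apply: filterS nI => z Iz; rewrite /= -(u0 _ Iz) /integral_from_inf.
by rewrite -Rintegral_mkcondl.
Qed.

Lemma integral_from_infE (R : realType) (I : set R) (f : R -> R) (y : R) :
  integral_from_inf I f y = \int[@lebesgue_measure R]_(t in `]-oo, y]) (f \_ I) t.
Proof. by rewrite /integral_from_inf -Rintegral_mkcondl. Qed.

Lemma continuous_integral_from_inf (R : realType) (I : set R) (f : R -> R) :
  measurable I -> (@lebesgue_measure R).-integrable I (EFin \o f) ->
  continuous (integral_from_inf I f).
Proof.
move=> mI if_ x.
have iv : (@lebesgue_measure R).-integrable setT (EFin \o (f \_ I)).
  by move: if_; rewrite integrable_mkcond//= restrict_EFin.
have ivS A : measurable A -> (@lebesgue_measure R).-integrable A (EFin \o (f \_ I)).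
  by move=> mA; exact: integrableS iv.
pose a := x - 1; pose b := x + 1.
have ab : a <= b by rewrite /a /b; lra.
have xab : x \in `]a, b[ by rewrite in_itv/= /a /b; apply/andP; split; lra.
have E y : y \in `]a, b[ -> integral_from_inf I f y =
    \int[@lebesgue_measure R]_(t in `]-oo, a]) (f \_ I) t +
    \int[@lebesgue_measure R]_(t in `[a, y]) (f \_ I) t.
  rewrite in_itv/= => /andP[ay yb]; rewrite integral_from_infE.
  rewrite -Rintegral_itv_obnd_cbnd; last exact: ivS.
  have := @Rintegral_itvB _ (f \_ I) -oo%O (BRight y) a (ivS _ (measurable_itv _)).
  rewrite !bnd_simp => /(_ isT (ltW ay)) <-.
  by rewrite addrC subrK.
have cab : {for x, continuous (fun y => \int[@lebesgue_measure R]_(t in `]-oo, a]) (f \_ I) t +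
    \int[@lebesgue_measure R]_(t in `[a, y]) (f \_ I) t)}.
  apply: cvgD; first exact: cvg_cst.
  have := parameterized_integral_continuous ab (ivS _ (measurable_itv _)).
  by move=> /(within_continuous_continuous) => /(_ x); apply => //;
    rewrite /a /b; lra.
rewrite /continuous_at E//; apply: cvg_trans cab; apply: near_eq_cvg.
have nab : \forall y \near x, y \in `]a, b[ by exact: near_in_itvoo.
by apply: filterS nab => y yab; rewrite E.
Qed.

(** * Joint measurability *)

Section joint_measurability.
Variables (R : realType) (d : measure_display) (T : measurableType d).
Variables (I : set R) (phi : R -> T -> R).
Hypothesis oI : open I.
Hypothesis mphi : forall x, I x ->
  measurable_fun [set: T] (phi x : T -> measurableTypeR R).
Let mI : measurable I. Proof. exact: open_measurable. Qed.

Definition grid (n : nat) (k : int) : R := k%:~R / n.+1%:R.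
Definition grid_floor (n : nat) (x : R) : R := grid n (Num.floor (x * n.+1%:R)).

Lemma grid_floor_itv n x : x - n.+1%:R^-1 <= grid_floor n x <= x.
Proof.
have /andP[h1 h2] := floor_itv (x * n.+1%:R).
rewrite /grid_floor /grid ler_pdivrMr// h1 andbT ler_pdivlMr// mulrBl mulVf//.
by rewrite lerBlDr ltW// -[1]/(1%:~R) -intrD.
Qed.

Lemma cvg_grid_floor x : grid_floor n x @[n --> \oo] --> x.
Proof.
apply: (@squeeze_cvgr _ _ _ _ (fun n => x - n.+1%:R^-1) (cst x)).
- by apply: nearW => n; exact: grid_floor_itv.
- exact: (@cvg_sub_harmonic R x).
- exact: cvg_cst.
Qed.

Lemma measurable_grid_approx n : measurable_fun [set: R * T]
  (fun z => if grid_floor n z.1 \in I then phi (grid_floor n z.1) z.2 else 0 : R).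
Proof.
move=> _ Y mY; rewrite setTI.
pose h k : T -> R := if grid n k \in I then phi (grid n k) else cst 0.
have mh k : measurable (h k @^-1` Y).
  rewrite -[X in measurable X]setTI /h; case: ifPn => [/set_mem|_].
    by move=> /mphi; apply.
  exact: measurable_cst.
have mfl k : measurable [set x : R | Num.floor (x * n.+1%:R) = k].
  rewrite (_ : [set x | _] = `[grid n k, grid n (k + 1)[%classic); last first.
    apply/seteqP; split => x /=; rewrite in_itv/= /grid.
      by move=> <-; rewrite ler_pdivrMr// ltr_pdivlMr// floor_itv.
    by rewrite ler_pdivrMr// ltr_pdivlMr// => /floor_def.
  exact: measurable_itv.
rewrite (_ : _ @^-1` Y =
    \bigcup_k ([set x : R | Num.floor (x * n.+1%:R) = k] `*` (h k @^-1` Y))).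
  apply: countable_bigcupT_measurable; first exact: countableP.
  by move=> k; apply: measurableX.
apply/seteqP; split => [[x w] /=|[x w] [k _] /= [<-]].
  move=> hY; exists (Num.floor (x * n.+1%:R)) => //; split => //=.
  by move: hY; rewrite /h /grid_floor; case: ifP.
by rewrite /h /grid_floor; case: ifP.
Qed.

Hypothesis cphi : forall x w, I x -> {for x, continuous (phi ^~ w)}.

(** [phi x w] is the limit of [phi (grid_floor n x) w]: a countably valued first
    argument makes the approximants measurable, and continuity in [x] gives the
    convergence. *)
Lemma caratheodory_measurable :
  measurable_fun (I `*` [set: T]) (fun z => phi z.1 z.2 : R).
Proof.
apply: (@measurable_fun_cvg _ _ _ _ (fun n z =>
  if grid_floor n z.1 \in I then phi (grid_floor n z.1) z.2 else 0)).
- by move=> n; apply: measurable_funTS; exact: measurable_grid_approx.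
move=> [x w] [/= Ix _].
have nI : nbhs x I by exact: open_nbhs_nbhs.
have nIn : \forall n \near \oo, I (grid_floor n x)
  by exact: (@cvg_grid_floor x I nI).
have := cvg_comp _ _ (@cvg_grid_floor x) (@cphi x w Ix).
apply: cvg_trans; apply: near_eq_cvg; apply: filterS nIn => n In.
by rewrite mem_set.
Qed.

Hypothesis dphi_ex : forall x w, I x -> derivable (phi ^~ w) x 1.

Lemma measurable_left_shift (r : R) :
  measurable_fun ((fun x => x - r) @^-1` I `*` [set: T]) (fun z => phi (z.1 - r) z.2 : R).
Proof.
have ms : measurable_fun setT (fun x : R => x - r) by exact: measurable_funB.
have msI : measurable ((fun x => x - r) @^-1` I).
  by rewrite -[X in measurable X]setTI; exact: ms.
have mpair : measurable_fun ((fun x => x - r) @^-1` I `*` [set: T])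
    (fun z : R * T => (z.1 - r, z.2)).
  apply: measurable_funTS; apply: measurable_fun_pair => /=.
    exact: measurableT_comp ms _.
  exact: measurable_snd.
apply: (measurable_comp _ _ caratheodory_measurable mpair).
  exact: (measurableX mI measurableT).
by move=> _ [[x w] /= [Ix _] <-].
Qed.

Lemma measurable_dphi :
  measurable_fun (I `*` [set: T]) (fun z => dphi phi z.1 z.2 : R).
Proof.
pose D n : set (R * T) := (fun x => x - n.+1%:R^-1) @^-1` I `*` [set: T].
have mIT : measurable (I `*` [set: T]) by exact: (measurableX mI measurableT).
apply: (@measurable_fun_cvg _ _ _ _ (fun n z =>
  n.+1%:R * (phi z.1 z.2 - ((fun z => phi (z.1 - n.+1%:R^-1) z.2) \_ (D n)) z))) => //.
- move=> n; apply: measurable_funM => //; apply: measurable_funB.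
    exact: caratheodory_measurable.
  apply: measurable_funTS; apply: (measurable_restrictT _ _).1.
    apply: measurableX => //.
    rewrite -[X in measurable X]setTI.
    have ms : measurable_fun setT (fun x : R => x - n.+1%:R^-1) by exact: measurable_funB.
    exact: ms.
  exact: measurable_left_shift.
move=> [x w] [/= Ix _].
have := derive1_left_quotient (@dphi_ex x w Ix).
apply: cvg_trans; apply: near_eq_cvg;
  apply: filterS (near_sub_harmonic oI Ix) => n In.
by rewrite patchE mem_set.
Qed.

End joint_measurability.

(** * The transfer operator *)

Section random_diffeomorphism.
Variables (R : realType) (d : measure_display) (Omega : measurableType d).
Variables (P : probability Omega R) (I : set R) (phi : R -> Omega -> R).
Variables (x0 : R).
Notation mu := (@lebesgue_measure R).
Hypotheses (itvI : is_interval I) (oI : open I) (Ix0 : I x0).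
Hypothesis phi_diffeo : forall w, diffeomorphism_onto I (phi ^~ w).
Hypothesis phi_meas : forall x, I x ->
  measurable_fun [set: Omega] (phi x : Omega -> measurableTypeR R).
Hypothesis P_plus : P (Omega_plus phi x0) = 1%E.
Let mI : measurable I. Proof. exact: open_measurable. Qed.

Lemma diffeo_phi x w : I x -> I (phi x w).
Proof. by case: (phi_diffeo w) => -[fI _ _] _; exact: fI. Qed.

Lemma diffeo_derivable x w : I x -> derivable (phi ^~ w) x 1.
Proof. by case: (phi_diffeo w) => _ [finv [_ dfI]] /dfI[]. Qed.

Lemma diffeo_continuous x w : I x -> {for x, continuous (phi ^~ w)}.
Proof. by move=> Ix; exact/derivable_continuous_at/diffeo_derivable. Qed.

Lemma diffeo_measurable :
  measurable_fun (I `*` [set: Omega]) (fun z => phi z.1 z.2 : R).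
Proof. exact: (caratheodory_measurable oI phi_meas diffeo_continuous). Qed.

Lemma diffeo_measurable_dphi :
  measurable_fun (I `*` [set: Omega]) (fun z => dphi phi z.1 z.2 : R).
Proof.
exact: (measurable_dphi oI phi_meas diffeo_continuous diffeo_derivable).
Qed.

Lemma measurable_section (e : measure_display) (S : measurableType e)
    (psi : R * Omega -> S) x : I x ->
  measurable_fun (I `*` [set: Omega]) psi ->
  measurable_fun [set: Omega] (fun w => psi (x, w)).
Proof.
move=> Ix mpsi; apply: (measurable_comp _ _ mpsi (pair1_measurable x)).
  exact: (measurableX mI measurableT).
by move=> _ [w _ <-].
Qed.

Lemma measurable_dphi_section x : I x -> measurable_fun [set: Omega] (dphi phi x).
Proof. by move=> Ix; exact: (measurable_section Ix diffeo_measurable_dphi). Qed.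

Lemma measurable_Omega_plus : measurable (Omega_plus phi x0).
Proof.
by apply: measurable_ltr_set => //; exact: measurable_dphi_section.
Qed.

Lemma negligible_Omega_minus : P (~` Omega_plus phi x0) = 0%E.
Proof.
by rewrite probability_setC ?P_plus ?subee//; exact: measurable_Omega_plus.
Qed.

Lemma Omega_minus_sub : Omega_minus phi x0 `<=` ~` Omega_plus phi x0.
Proof. by move=> w /= + /(lt_trans) => h /(_ _ h); rewrite ltxx. Qed.

Lemma ae_Omega_plus : {ae P, forall w, Omega_plus phi x0 w}.
Proof.
exists (~` Omega_plus phi x0); split => //.
- exact/measurableC/measurable_Omega_plus.
- exact: negligible_Omega_minus.
Qed.

Lemma Omega_plus_increasing w : Omega_plus phi x0 w ->
  forall x y, I x -> I y -> x < y -> phi x w < phi y w.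
Proof. exact: (diffeomorphism_increasing itvI oI (phi_diffeo w) Ix0). Qed.

Lemma integral_Omega_plus (u : Omega -> \bar R) :
  measurable_fun setT u ->
  (\int[P]_(w in Omega_plus phi x0) u w = \int[P]_w u w)%E.
Proof.
move=> mu'; have mO := measurable_Omega_plus.
rewrite integral_mkcond; apply: ae_eq_integral => //.
  by apply: (measurable_restrictT _ mO).1; exact: measurable_funTS.
apply: filterS ae_Omega_plus => w Ow _.
by rewrite patchE mem_set.
Qed.

Lemma measurable_comp_phi (f : R -> R) x : measurable_fun I f -> I x ->
  measurable_fun [set: Omega] (fun w => f (phi x w)).
Proof.
move=> mf Ix; apply: (measurable_comp mI _ mf); last exact: (phi_meas Ix).
by move=> _ [w _ <-]; exact: diffeo_phi.
Qed.

Section transfer_kernel.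
Variable f : R -> R.
Hypothesis if_ : mu.-integrable I (EFin \o f).

Let mf : measurable_fun I f.
Proof. by have := measurable_int _ if_; move/measurable_EFinP. Qed.

(** Extended by zero off [I], where the measurability of [phi] is not under
    control, so that Fubini applies on the whole product space. *)
Definition transfer_kernel (z : R * Omega) : R :=
  ((fun z => `|dphi phi z.1 z.2| * f (phi z.1 z.2)) \_ (I `*` [set: Omega])) z.

Lemma transfer_kernelE x w : I x ->
  transfer_kernel (x, w) = `|dphi phi x w| * f (phi x w).
Proof. by move=> Ix; rewrite /transfer_kernel patchE mem_set. Qed.

Lemma measurable_transfer_kernel : measurable_fun [set: R * Omega] transfer_kernel.
Proof.
apply: (measurable_restrictT _ _).1; first exact: (measurableX mI measurableT).
apply: measurable_funM.
  by apply: measurableT_comp => //; exact: diffeo_measurable_dphi.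
apply: (measurable_comp mI _ mf); last exact: diffeo_measurable.
by move=> _ [[x w] [/= Ix _] <-]; exact: diffeo_phi.
Qed.

(** Change of variables at fixed [w], localised to a set [A] of image points.
    The choice [A = setT] yields integrability of the kernel, and the
    half-line below [phi x w] yields the primitive of [f] at [phi x w]. *)
Lemma integral_transfer_kernel (A : set R) w :
  measurable A -> Omega_plus phi x0 w ->
  (\int[mu]_(t in I `&` [set t | A (phi t w)]) (transfer_kernel (t, w))%:E =
   \int[mu]_(u in I `&` A) (f u)%:E)%E.
Proof.
move=> mA Ow; have inc := Omega_plus_increasing Ow.
have [phi_bij [finv [finvK dfI]]] := phi_diffeo w.
have df x (Ix : I x) : derivable (phi ^~ w) x 1 := (dfI x Ix).1.
have dfinv x (Ix : I x) : derivable finv x 1 := (dfI x Ix).2.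
have mfA : measurable_fun I (f \_ A).
  apply: (measurable_restrict f mA mI).1; apply: (measurable_funS mI _ mf).
  exact: subIsetl.
rewrite [RHS]integral_mkcondr restrict_EFin.
rewrite -(integral_comp_derive_EFin oI phi_bij finvK df dfinv inc mfA).
rewrite integral_mkcondr; apply: eq_integral => t; rewrite inE => It.
rewrite !patchE transfer_kernelE//.
have -> : (phi t w \in A) = (t \in [set t | A (phi t w)]).
  by apply/idP/idP; rewrite !inE.
case: ifPn => _; last by rewrite mul0r.
by rewrite ger0_norm ?(increasing_derive1_ge0 oI df inc)// mulrC.
Qed.

End transfer_kernel.

Section transfer.
Variable f : R -> R.
Hypothesis if_ : mu.-integrable I (EFin \o f).
Let Psi := transfer_kernel f.

Let mPsi : measurable_fun [set: measurableTypeR R * Omega] (EFin \o Psi).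
Proof. by apply/measurable_EFinP; exact: measurable_transfer_kernel. Qed.

Lemma integrable_transfer_kernel :
  (mu \x P)%E.-integrable [set: measurableTypeR R * Omega] (EFin \o Psi).
Proof.
have iaf : mu.-integrable I (EFin \o (Num.Def.normr \o f))
  by exact: integrable_norm.
apply: (@integrable21ltyP _ _ (measurableTypeR R) Omega R mu P _ mPsi).2.
pose N := (\int[mu]_(u in I) (`|f u|)%:E)%E.
have -> : (\int[P]_w \int[mu]_t `|(EFin \o Psi) (t, w)| =
    \int[P]_w (cst N) w)%E.
  apply: ae_eq_integral => //.
    have mabs : measurable_fun [set: measurableTypeR R * Omega]
        (fun z => `|(EFin \o Psi) z|%E) by exact: measurableT_comp.
    exact: (@measurable_fun_fubini_tonelli_G _ _ _ _ R mu _ mabs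
      (fun z => abse_ge0 _)).
  apply: filterS ae_Omega_plus => w Ow _.
  rewrite /= /N -[in RHS](setIT I) -(integral_transfer_kernel iaf measurableT Ow) integral_mkcond.
  rewrite [RHS]integral_mkcond; apply: eq_integral => t _ /=.
  rewrite patch_setT patchE /Psi; case: ifPn => [/set_mem[It _]|/negP nIt].
    by rewrite !transfer_kernelE//= normrM normr_id.
  rewrite /transfer_kernel patchE memNset ?normr0// => -[It _].
  by apply: nIt; exact/mem_set.
rewrite integral_cst// [X in (_ * X)%E](_ : _ = 1%E) ?mule1;
  last exact: probability_setT.
by have /integrableP[_] := if_.
Qed.

Definition transfer (x : R) : R := \int[P]_w (Psi (x, w)).

Let Fub (x : measurableTypeR R) : \bar R := (\int[P]_w (Psi (x, w))%:E)%E.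

Let iFub : mu.-integrable setT Fub.
Proof. exact: (integrable_fubini_F integrable_transfer_kernel). Qed.

Let ae_Fub : {ae mu, forall x, (transfer x)%:E = Fub x}.
Proof.
have := integrable_ae measurableT iFub; apply: filterS.
by move=> x /(_ Logic.I) fx; rewrite /transfer /Rintegral fineK.
Qed.

Let mtransfer : measurable_fun setT transfer.
Proof.
apply: (measurableT_comp (fine_measurable measurableT)).
exact: measurable_int iFub.
Qed.

Lemma integrable_transfer : mu.-integrable I (EFin \o transfer).
Proof.
apply: (@integrableS _ _ _ mu setT I) => //.
apply/integrableP; split; first exact/measurable_EFinP.
rewrite (_ : (\int[mu]_x `|(EFin \o transfer) x| = \int[mu]_x `|Fub x|)%E).
  by have /integrableP[] := iFub.
apply: ae_eq_integral => //.
- by apply: measurableT_comp => //; exact/measurable_EFinP.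
- by apply: measurableT_comp => //; exact: measurable_int iFub.
- by apply: (@filterS _ _ (ae_filter_ringOfSetsType mu) _ _ _ ae_Fub) => x E _;
    rewrite -E.
Qed.

(** Fubini for the kernel restricted to the first coordinates at most [x]; since
    [phi ^~ w] is increasing, [t <= x] amounts to [phi t w <= phi x w]. *)
Lemma integral_from_inf_transfer x : I x ->
  integral_from_inf I transfer x = \int[P]_w integral_from_inf I f (phi x w).
Proof.
move=> Ix.
pose S : set (measurableTypeR R * Omega) := `]-oo, x]%classic `*` setT.
have mS : measurable S by exact: (measurableX (measurable_itv _) measurableT).
pose K : measurableTypeR R * Omega -> \bar R := (EFin \o Psi) \_ S.
have iS : (mu \x P)%E.-integrable [set: measurableTypeR R * Omega] K.
  by apply: (integrable_mkcond _ mS).1;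
    exact: integrableS integrable_transfer_kernel.
have := Fubini iS.
have -> : (\int[mu]_t \int[P]_w K (t, w) =
    \int[mu]_(t in [set t | I t /\ (t <= x)%R]) (transfer t)%:E)%E.
  have mIx := measurable_setI_le x mI.
  rewrite [RHS]integral_mkcond; apply: ae_eq_integral => //.
  - exact: (measurable_fubini_F iS).
  - apply: (measurable_restrictT _ mIx).1; apply/measurable_EFinP.
    exact: measurable_funTS.
  apply: (@filterS _ _ (ae_filter_ringOfSetsType mu) _ _ _ ae_Fub) => t E _;
    rewrite patchE E /Fub.
  case: ifPn => [/set_mem[It tx]|/negP nItx].
    apply: eq_integral => w _; rewrite /K patchE mem_set// /S; split => //.
  apply: integral0_eq => w _; rewrite /K patchE; case: ifPn => // /set_mem[].
  rewrite /= in_itv/= => tx _;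
    rewrite /Psi /transfer_kernel patchE memNset// => -[It _].
  by apply: nItx; exact/mem_set.
have -> : (\int[P]_w \int[mu]_t K (t, w) =
    \int[P]_w (integral_from_inf I f (phi x w))%:E)%E.
  apply: ae_eq_integral => //.
  - exact: (measurable_fubini_G iS).
  - apply/measurable_EFinP; apply: measurable_comp_phi => //.
    apply: measurable_funTS; apply: continuous_measurable_fun.
    exact: continuous_integral_from_inf.
  apply: filterS ae_Omega_plus => w Ow _.
  have mA : measurable [set u : R | u <= phi x w].
    by rewrite -set_itvNyc; exact: measurable_itv.
  have mIA : measurable (I `&` [set u | u <= phi x w]) by exact: measurableI.
  rewrite /integral_from_inf /Rintegral fineK; last first.
    apply: integrable_fin_num; first exact: mIA.
    exact: (@integrableS _ _ _ mu _ _ _ mI mIA (@subIsetl _ _ _) if_).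
  rewrite -(integral_transfer_kernel if_ mA Ow) [RHS]integral_mkcond.
  apply: eq_integral => t _; rewrite /K !patchE.
  have [It|nIt] := pselect (I t); last first.
    have K0 : Psi (t, w) = 0.
      by rewrite /Psi /transfer_kernel patchE memNset// => -[].
    by rewrite /= -/(Psi (t, w)) K0; do 2 case: ifP.
  rewrite (_ : (t, w) \in S = (t \in I `&` [set t | phi t w <= phi x w]))//.
  have inc := Omega_plus_increasing Ow.
  apply/idP/idP; rewrite !inE /S/= in_itv/=.
    move=> [tx _]; split => //; move: tx; rewrite le_eqVlt => /orP[/eqP->//|tx].
    exact/ltW/inc.
  move=> [_]; rewrite leNgt => /negP ptx; split => //; rewrite leNgt.
  by apply/negP => /(inc _ _ Ix It).
by move=> E; rewrite /integral_from_inf /Rintegral E.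
Qed.

End transfer.

End random_diffeomorphism.

Section random_diffeomorphism.
Variables (R : realType) (d : measure_display) (Omega : measurableType d).
Variables (P : probability Omega R) (I : set R) (phi : R -> Omega -> R).
Variables (x0 : R).
Notation mu := (@lebesgue_measure R).
Hypotheses (itvI : is_interval I) (oI : open I) (Ix0 : I x0).
Hypothesis phi_diffeo : forall w, diffeomorphism_onto I (phi ^~ w).
Hypothesis phi_meas : forall x, I x ->
  measurable_fun [set: Omega] (phi x : Omega -> measurableTypeR R).
Hypothesis P_plus : P (Omega_plus phi x0) = 1%E.
Let mI : measurable I. Proof. exact: open_measurable. Qed.

Hypothesis P_complete : measure_is_complete P.
Hypothesis phi_nonsingular : nonsingular P I phi.

Lemma measurable_Omega_minus : measurable (Omega_minus phi x0).
Proof.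
apply: measurable_ltr_set => //.
exact: (measurable_dphi_section oI phi_diffeo phi_meas).
Qed.

Lemma Omega_minus0 : P (Omega_minus phi x0) = 0%E.
Proof.
apply: (subset_measure0 measurable_Omega_minus _ (@Omega_minus_sub _ _ _ _ _)).
  exact/measurableC/(measurable_Omega_plus oI Ix0 phi_diffeo phi_meas).
exact: (negligible_Omega_minus oI Ix0 phi_diffeo phi_meas P_plus).
Qed.

(** Nonsingularity makes the set of pairs sent by [phi] into the exceptional set
    null for the product measure, so almost all of its sections are null. *)
Lemma ae_comp_phi (f h : R -> R) : 
  {ae mu, forall x, I x -> h x = f x} ->
  {ae mu, forall x, I x -> {ae P, forall w, h (phi x w) = f (phi x w)}}.
Proof.
move=> [N [mN N0 hN]].
have mN' : measurable (N `&` I : set (measurableTypeR R)) by exact: measurableI.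
have NI0 : mu (N `&` I) = 0%E.
  exact: (subset_measure0 mN' mN (@subIsetl _ _ _)).
pose S : set (measurableTypeR R * Omega) :=
  [set z | I z.1 /\ (N `&` I) (phi z.1 z.2)].
have mS : measurable S.
  have := diffeo_measurable oI phi_diffeo phi_meas (measurableX mI measurableT) mN'.
  rewrite (_ : S = (I `*` setT) `&` (fun z => phi z.1 z.2) @^-1` (N `&` I))//.
  by apply/seteqP; split => [z [? ?]|z [[? ?] ?]].
have S0 : (mu \x P)%E S = 0%E
  by exact: (phi_nonsingular mN' (@subIsetr _ _ _) NI0).
have : ae_eq mu setT (P \o xsection S) (cst 0%E).
  apply/ae_eq_integral_abs => //; first exact: measurable_fun_xsection.
  rewrite -[RHS]S0; apply: eq_integral => x _ /=.
  by rewrite gee0_abs.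
apply: (@filterS _ _ (ae_filter_ringOfSetsType mu)) => x /= /(_ Logic.I) Sx Ix.
exists (xsection S x); split => //; first exact: measurable_xsection.
move=> w /= hf; rewrite /xsection/= inE; split => //; split => /=.
  by apply: hN => /= /(_ (diffeo_phi phi_diffeo w Ix)).
exact: (diffeo_phi phi_diffeo).
Qed.

(** The primitives of [f] and of [transfer + g] agree, hence so do the functions
    almost everywhere; [P_complete] transfers measurability of the integrand
    from [f] to an arbitrary representative [h]. *)
Lemma L1_solution_of_antiderivative (alpha : R) (g F f : R -> R) :
  mu.-integrable I (EFin \o g) ->
  integrated_solution P I phi x0 alpha g F ->
  mu.-integrable I (EFin \o f) ->
  (forall x, I x -> F x = integral_from_inf I f x) ->
  L1_solution P I phi g f.
Proof.
move=> ig Fsol if_ Ff.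
have itf := integrable_transfer itvI oI Ix0 phi_diffeo phi_meas P_plus if_.
have mIx x := measurable_setI_le x mI.
have sIx x : [set t | I t /\ t <= x] `<=` I by move=> t [].
have ifB : mu.-integrable I (EFin \o (fun t => f t - transfer P I phi f t)).
  exact: (@integrable_EFinB _ _ _ mu _ _ _ mI if_ itf).
have resid0 x : I x ->
    integral_from_inf I (fun t => f t - transfer P I phi f t - g t) x = 0.
  move=> Ix; have [iFp iFm Fx] := Fsol x Ix.
  have Em : \int[P]_(w in Omega_minus phi x0) (alpha - F (phi x w)) = 0.
    rewrite /Rintegral null_set_integral//; last exact: Omega_minus0.
    - exact: measurable_Omega_minus.
    - exact: measurable_int iFm.
  have Ep : \int[P]_(w in Omega_plus phi x0) F (phi x w) =
      integral_from_inf I (transfer P I phi f) x.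
    rewrite (integral_from_inf_transfer itvI oI Ix0 phi_diffeo phi_meas P_plus if_ Ix).
    have -> : \int[P]_(w in Omega_plus phi x0) F (phi x w) =
        \int[P]_(w in Omega_plus phi x0) integral_from_inf I f (phi x w).
      by apply: eq_Rintegral => w _; rewrite Ff//;
        exact: (diffeo_phi phi_diffeo).
    rewrite /Rintegral (integral_Omega_plus oI Ix0 phi_diffeo phi_meas P_plus)//.
    apply/measurable_EFinP;
      apply: (measurable_comp_phi oI phi_diffeo phi_meas) => //.
    apply: measurable_funTS; apply: continuous_measurable_fun.
    exact: continuous_integral_from_inf.
  move: Fx; rewrite Ff// Em addr0 Ep => Fx.
  have iS k : mu.-integrable I (EFin \o k) -> mu.-integrable [set t | I t /\ t <= x] (EFin \o k).
    exact: (@integrableS _ _ _ mu _ _ _ mI (mIx x) (sIx x)).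
  rewrite /integral_from_inf RintegralB; [|exact: mIx|exact: iS ifB|exact: iS].
  rewrite RintegralB; [|exact: mIx|exact: iS|exact: iS].
  by move: Fx; rewrite /integral_from_inf => ->; lra.
have iresid : mu.-integrable I (EFin \o (fun t => f t - transfer P I phi f t - g t)).
  exact: (@integrable_EFinB _ _ _ mu _ _ _ mI ifB ig).
have aef := ae_eq0_of_integral_eq0 oI iresid resid0.
have aeK := ae_integrable1 (integrable_transfer_kernel itvI oI Ix0 phi_diffeo phi_meas P_plus if_).
move=> h hf; have aeh := ae_comp_phi hf.
have aeF := ae_filter_ringOfSetsType mu.
apply: (@filterS2 _ _ aeF _ _ _ _ (filterI hf aef) (filterI aeK aeh)).
move=> x [hx fx] [iK hphi] Ix.
pose K := fun w => (`|dphi phi x w| * f (phi x w))%:E.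
pose Kh := fun w => (`|dphi phi x w| * h (phi x w))%:E.
have {}iK : P.-integrable setT K.
  by apply: eq_integrable iK => // w _; rewrite /K/= transfer_kernelE.
have KKh : ae_eq P setT K Kh.
  by apply: filterS (hphi Ix) => w hw _; rewrite /K /Kh hw.
have mK := measurable_int _ iK.
have mKh : measurable_fun setT Kh := ae_measurable_fun P_complete KKh mK.
have iKh : P.-integrable setT Kh.
  apply/integrableP; split => //.
  rewrite (_ : (\int[P]_w `|Kh w| = \int[P]_w `|K w|)%E); last first.
    apply: ae_eq_integral => //;
      [exact: measurableT_comp|exact: measurableT_comp|].
    by apply: filterS KKh => w hw /hw ->.
  by have /integrableP[] := iK.
split; first exact: iKh.
have -> : \int[P]_w (`|dphi phi x w| * h (phi x w)) = transfer P I phi f x.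
  rewrite /transfer /Rintegral; congr fine.
  rewrite (_ : (\int[P]_w (transfer_kernel I phi f (x, w))%:E)%E = (\int[P]_w K w)%E).
    by apply: ae_eq_integral => //; apply: filterS KKh => w hw /hw ->.
  by apply: eq_integral => w _; rewrite transfer_kernelE.
by rewrite hx//; move: (fx Ix); lra.
Qed.

End random_diffeomorphism.

(** * Independence of the iterates and of the next parameter *)

Section coordinates.
Variables (R : realType) (d : measure_display) (Omega : measurableType d).
Variables (P : probability Omega R) (Pinf : probability (Omega_seq Omega) R).
Hypothesis Pinf_prod : is_product_probability P Pinf.

(** A pi-system generating the events that depend on the first [n] coordinates
    only. *)
Definition cylinders (n : nat) : set (set (nat -> Omega)) :=
  [set C | exists2 A : nat -> set Omega, (forall i, measurable (A i)) &
    C = [set w | forall i, (i < n)%N -> A i (w i)]].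

Lemma coordinate_measurable n :
  measurable_fun [set: Omega_seq Omega] (fun w : Omega_seq Omega => w n).
Proof.
move=> _ Y mY; rewrite setTI; apply: sub_gen_smallest.
by exists n => //; exists Y => //; rewrite setTI.
Qed.

Lemma setI_closed_cylinders n : setI_closed (cylinders n).
Proof.
move=> _ _ [A mA ->] [B mB ->]; exists (fun i => A i `&` B i).
  by move=> i; exact: measurableI.
apply/seteqP; split => [w [wA wB] i ni|w wAB]; first by split;
  [exact: wA|exact: wB].
by split => i /wAB[].
Qed.

Lemma cylinders_measurable n (C : set (Omega_seq Omega)) :
  cylinders n C -> measurable C.
Proof.
move=> [A mA ->].
rewrite (_ : [set w | _] = \bigcap_(i in [set i | (i < n)%N])
    ((fun w : Omega_seq Omega => w i) @^-1` A i)).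
  apply: bigcap_measurableType => i _; rewrite -[X in measurable X]setTI.
  exact: coordinate_measurable.
by apply/seteqP; split => w wA i /wA.
Qed.

Lemma sigma_cylinders_measurable n (C : set (Omega_seq Omega)) :
  <<s cylinders n >> C -> measurable C.
Proof.
apply: smallest_sub; first exact: sigma_algebra_measurable.
by move=> D; exact: cylinders_measurable.
Qed.

Lemma sub_cylindersS n : cylinders n `<=` cylinders n.+1.
Proof.
move=> _ [A mA ->].
exists (fun i => if (i < n)%N then A i else setT).
  by move=> i; case: ifP.
apply/seteqP; split => w wA i ni; last first.
  by have := wA i (ltnW ni); rewrite ni.
by case: ifP => // /wA.
Qed.

Lemma coordinate_cylinder n (B : set Omega) : measurable B ->
  cylinders n.+1 [set w | B (w n)].
Proof.
move=> mB; exists (fun i => if i == n then B else setT).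
  by move=> i; case: ifP.
apply/seteqP; split => w; last by move=> /(_ n (ltnSn n)) /=; rewrite eqxx.
by move=> Bw i _; case: eqP => // ->.
Qed.

(** Both sides are finite measures in [C], equal on the pi-system of rectangles
    by the product formula. *)
Lemma cylinders_coordinate_indep n (C : set (Omega_seq Omega)) (B : set Omega) :
  <<s cylinders n >> C -> measurable B ->
  Pinf (C `&` [set w | B (w n)]) = (Pinf C * P B)%E.
Proof.
move=> sC mB.
have mBn : measurable ([set w | B (w n)] : set (Omega_seq Omega)).
  by rewrite -[X in measurable X]setTI; exact: coordinate_measurable.
have PB : (fine (P B))%:E = P B by rewrite fineK// fin_num_measure.
pose r : {nonneg R} := NngNum (fine_ge0 (measure_ge0 P B)).
pose m1 : {measure set (Omega_seq Omega) -> \bar R} := mrestr Pinf mBn.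
pose m2 : {measure set (Omega_seq Omega) -> \bar R} := mscale r Pinf.
have cylT : cylinders n setT.
  by exists (fun=> setT) => //; apply/seteqP; split.
have m2E D : m2 D = (P B * Pinf D)%E by rewrite -[in RHS]PB.
suff : m1 C = m2 C by rewrite m2E muleC.
apply: (@g_sigma_algebra_measure_unique _ R (Omega_seq Omega) (cylinders n) _ (fun=> setT) _ _ m1 m2) => //.
- by move=> D; exact: cylinders_measurable.
- by apply/seteqP; split => // w _; exists 0%N.
- exact: setI_closed_cylinders.
- move=> _ [A mA ->].
  rewrite m2E.
  pose A' i := if i == n then B else A i.
  have mA' i : measurable (A' i) by rewrite /A'; case: ifP.
  have E : [set w | forall i, (i < n)%N -> A i (w i)] `&` [set w | B (w n)] =
      [set w : Omega_seq Omega | forall i, (i < n.+1)%N -> A' i (w i)].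
    apply/seteqP; split => [w [wA Bw] i|w wA].
      rewrite ltnS /A'; case: eqP => [->//|/eqP ni].
      by rewrite leq_eqVlt (negPf ni) => /wA.
    split => [i ni|].
      by have := wA i (ltnW ni); rewrite /A' ltn_eqF.
    by have := wA n (ltnSn n); rewrite /A' eqxx.
  have -> : m1 [set w | forall i, (i < n)%N -> A i (w i)] =
      Pinf [set w : Omega_seq Omega | forall i, (i < n.+1)%N -> A' i (w i)].
    by rewrite -E.
  rewrite !Pinf_prod// big_ord_recr/= /A' eqxx muleC; congr (_ * _)%E.
  by apply: eq_bigr => i _; rewrite ltn_eqF.
- move=> _; rewrite /m1 /mrestr; apply: (@le_lt_trans _ _ (Pinf setT)).
    by apply: le_measure; rewrite ?inE//; exact: measurableI.
  by rewrite probability_setT ltry.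
Qed.

End coordinates.

Section iterates.
Variables (R : realType) (d : measure_display) (Omega : measurableType d).
Variables (P : probability Omega R) (I : set R) (phi : R -> Omega -> R).
Variables (Pinf : probability (Omega_seq Omega) R).
Notation mu := (@lebesgue_measure R).
Hypotheses (oI : open I).
Hypothesis phi_diffeo : forall w, diffeomorphism_onto I (phi ^~ w).
Hypothesis phi_meas : forall x, I x ->
  measurable_fun [set: Omega] (phi x : Omega -> measurableTypeR R).
Let mI : measurable I. Proof. exact: open_measurable. Qed.

Hypothesis Pinf_prod : is_product_probability P Pinf.

Lemma phi0_iter_in n x (w : nat -> Omega) : I x -> I (phi0_iter I phi n x w).
Proof.
move=> Ix; elim: n => //= n IHn.
by rewrite /phi0 mem_set//; exact: (diffeo_phi phi_diffeo).
Qed.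

Lemma phi0_iterS n x (w : nat -> Omega) : I x ->
  phi0_iter I phi n.+1 x w = phi (phi0_iter I phi n x w) (w n).
Proof. by move=> Ix; rewrite /= /phi0 mem_set//; exact: phi0_iter_in. Qed.

(** Adaptedness: this makes the parameter of index [n] independent of the [n]-th
    iterate. *)
Lemma phi0_iter_cylinders n x (A : set R) : I x -> measurable A ->
  <<s @cylinders _ Omega n >> (phi0_iter I phi n x @^-1` A).
Proof.
move=> Ix; elim: n A => [|n IHn] A mA.
  have [Ax|nAx] := pselect (A x).
    rewrite (_ : _ @^-1` A = setT); last by apply/seteqP; split.
    exact: (@measurableT _ (g_sigma_algebraType (@cylinders _ Omega 0))).
  rewrite (_ : _ @^-1` A = set0); last by apply/seteqP; split.
  exact: (@measurable0 _ (g_sigma_algebraType (@cylinders _ Omega 0))).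
pose T := g_sigma_algebraType (@cylinders _ Omega n.+1).
have mX : measurable_fun [set: T] (phi0_iter I phi n x : T -> R).
  move=> _ Y mY; rewrite setTI.
  apply: (sub_sigma_algebra2 _ (IHn _ mY)); exact: sub_cylindersS.
have mw : measurable_fun [set: T] (fun w : T => w n).
  move=> _ Y mY; rewrite setTI; apply: sub_gen_smallest.
  exact: coordinate_cylinder.
have mp : measurable_fun [set: T] (fun w : T => (phi0_iter I phi n x w, w n)).
  exact: measurable_fun_pair.
have mphi := diffeo_measurable oI phi_diffeo phi_meas.
have : measurable_fun [set: T] (fun w : T => phi (phi0_iter I phi n x w) (w n)).
  apply: (measurable_comp (measurableX mI measurableT) _ mphi mp).
  by move=> _ [w _ <-]; split => //=; exact: phi0_iter_in.
move=> /(_ measurableT A mA); rewrite setTI.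
suff -> : (fun w : T => phi (phi0_iter I phi n x w) (w n)) =
  phi0_iter I phi n.+1 x by [].
by apply/funext => w; rewrite phi0_iterS.
Qed.

Lemma phi0_iter_measurable n x : I x ->
  measurable_fun [set: Omega_seq Omega]
    (phi0_iter I phi n x : Omega_seq Omega -> measurableTypeR R).
Proof.
move=> Ix _ Y mY; rewrite setTI; apply: (@sigma_cylinders_measurable _ _ n).
exact: phi0_iter_cylinders.
Qed.

Definition transition (u : R -> R) (y : R) : R := \int[P]_w u (phi y w).

Lemma transition_integrable (u : R -> R) (M : R) y :
  measurable_fun I u -> (forall y, I y -> `|u y| <= M) -> I y ->
  P.-integrable setT (EFin \o (fun w => u (phi y w))).
Proof.
move=> mu_ uM Iy; apply: (@bounded_integrable _ _ _ P _ M).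
- by rewrite -ge0_fin_numE// fin_num_measure.
- exact: (measurable_comp_phi oI phi_diffeo phi_meas).
- by move=> w; exact/uM/(diffeo_phi phi_diffeo).
Qed.

Lemma transition_bounded (u : R -> R) (M : R) y :
  measurable_fun I u -> (forall y, I y -> `|u y| <= M) -> I y ->
  `|transition u y| <= M.
Proof.
move=> mu_ uM Iy; have iu := transition_integrable mu_ uM Iy.
apply: (le_trans (le_normr_Rintegral measurableT iu)).
have -> : M = \int[P]_w (cst M w).
  by rewrite Rintegral_cst// [X in fine X]probability_setT mulr1.
apply: le_Rintegral => //.
- exact: integrable_norm.
- exact: finite_measure_integrable_cst.
- by move=> w _; exact/uM/(diffeo_phi phi_diffeo).
Qed.

(** The Markov property: by independence the joint law of the [n]-th iterate and
    of the parameter of index [n] is a product, over which Fubini integrates the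
    parameter first. *)
Lemma integral_phi0_iterS (u : R -> R) (M : R) n x :
  measurable_fun I u -> (forall y, I y -> `|u y| <= M) -> I x ->
  (\int[Pinf]_w (u (phi0_iter I phi n.+1 x w))%:E =
   \int[Pinf]_w (transition u (phi0_iter I phi n x w))%:E)%E.
Proof.
move=> mu_ uM Ix; set X := phi0_iter I phi n x.
have M0 : 0 <= M by apply: le_trans (uM x Ix).
have mX := @phi0_iter_measurable n x Ix.
have mw := @coordinate_measurable _ Omega n.
pose X' : {RV Pinf >-> measurableTypeR R} :=
  HB.pack (X : Omega_seq Omega -> measurableTypeR R)
    (isMeasurableFun.Build _ _ _ _ _ mX).
pose m1 := distribution Pinf X'.
pose Z : Omega_seq Omega -> measurableTypeR R * Omega := fun w => (X w, w n).
have mZ : measurable_fun [set: Omega_seq Omega] Z by exact: measurable_fun_pair.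
pose Z' : {mfun Omega_seq Omega >-> (measurableTypeR R * Omega)%type} :=
  HB.pack Z (isMeasurableFun.Build _ _ _ _ _ mZ).
pose H : measurableTypeR R * Omega -> R :=
  (fun z => u (phi z.1 z.2)) \_ (I `*` [set: Omega]).
have mIO : measurable (I `*` [set: Omega]) := measurableX mI measurableT.
have mH : measurable_fun [set: measurableTypeR R * Omega] H.
  apply: (measurable_restrictT _ mIO).1.
  apply: (measurable_comp mI _ mu_);
    last exact: (diffeo_measurable oI phi_diffeo phi_meas).
  by move=> _ [[y w] [/= Iy _] <-]; exact: (diffeo_phi phi_diffeo).
have HM z : `|H z| <= M.
  rewrite /H patchE; case: ifPn => [/set_mem[Iz _]|_]; last by rewrite normr0.
  exact/uM/(diffeo_phi phi_diffeo).
have iH : (m1 \x P)%E.-integrable [set: measurableTypeR R * Omega] (EFin \o H).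
  apply: (@bounded_integrable _ _ _ (m1 \x P)%E _ M) => //.
    have := @product_measure1E _ _ _ _ R m1 P setT setT measurableT measurableT.
    rewrite setXTT => E; apply: (@le_lt_trans _ _ (m1 setT * P setT)%E).
      by rewrite le_eqVlt; apply/orP; left; apply/eqP; exact: E.
    by rewrite lte_mul_pinfty // ?fin_num_measure// -ge0_fin_numE// fin_num_measure.
have Hu w : H (Z w) = u (phi0_iter I phi n.+1 x w).
  by rewrite /H /Z patchE mem_set ?phi0_iterS//; split => //=;
    exact: phi0_iter_in.
transitivity (\int[Pinf]_w ((EFin \o H) \o Z) w)%E.
  by apply: eq_integral => w _ /=; rewrite Hu.
have P1 : (Pinf setT < +oo)%E by rewrite probability_setT ltry.
have mEH : measurable_fun [set: measurableTypeR R * Omega] (EFin \o H).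
  exact/measurable_EFinP.
transitivity (\int[pushforward Pinf Z]_z (EFin \o H) z)%E.
  rewrite (@integral_pushforward _ _ _ _ R Z mZ Pinf setT) ?preimage_setT//.
  apply: (@bounded_integrable _ _ _ Pinf (H \o Z) M) => //.
    exact: measurableT_comp.
  by move=> w; exact: HM.
transitivity (\int[m1 \x P]_z (EFin \o H) z)%E.
  apply: eq_measure_integral => A mA _.
  apply/esym; apply: (@product_measure_unique _ _ _ _ R m1 P (distribution Pinf Z')) => //.
  move=> B C mB mC.
  rewrite [LHS](_ : _ = Pinf ((X @^-1` B) `&` [set w | C (w n)]))//.
  by rewrite (cylinders_coordinate_indep Pinf_prod)//;
    exact: phi0_iter_cylinders.
have transE y : I y -> (\int[P]_w (H (y, w))%:E)%E = (transition u y)%:E.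
  move=> Iy; have -> : (\int[P]_w (H (y, w))%:E = \int[P]_w (u (phi y w))%:E)%E.
    by apply: eq_integral => w _; rewrite /H patchE mem_set.
  rewrite /transition /Rintegral fineK//; apply: integrable_fin_num => //.
  exact: transition_integrable mu_ uM Iy.
rewrite -(integral12_prod_meas1 iH).
have mF := measurable_fubini_F iH.
rewrite (@integral_pushforward _ _ (Omega_seq Omega) (measurableTypeR R) R X mX Pinf setT) ?preimage_setT//.
  by apply: eq_integral => w _; rewrite /= /fubini_F/= transE//;
    exact: phi0_iter_in.
have -> : fubini_F P (EFin \o H) \o X = EFin \o (fun w => transition u (X w)).
  by apply/funext => w; rewrite /= /fubini_F/= transE//; exact: phi0_iter_in.
apply: (@bounded_integrable _ _ _ Pinf _ M) => //.
  apply/measurable_EFinP.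
  rewrite (_ : EFin \o _ = fubini_F P (EFin \o H) \o X).
    exact: measurableT_comp mF mX.
  by apply/funext => w; rewrite /= /fubini_F/= transE//; exact: phi0_iter_in.
by move=> w; apply: transition_bounded mu_ uM _; exact: phi0_iter_in.
Qed.

End iterates.

(** * The primitive of g against the limit law *)

Section primitive.
Variables (R : realType) (I : set R) (g : R -> R).
Notation mu := (@lebesgue_measure R).
Hypothesis mI : measurable I.
Hypothesis ig : mu.-integrable I (EFin \o g).

Lemma integral_from_inf_bounded x :
  `|integral_from_inf I g x| <= \int[mu]_(t in I) `|g t|.
Proof.
have mIx := measurable_setI_le x mI.
have sIx : [set t | I t /\ t <= x] `<=` I by move=> t [].
have igx : mu.-integrable [set t | I t /\ t <= x] (EFin \o g).
  exact: (@integrableS _ _ _ mu _ _ _ mI mIx sIx).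
apply: (le_trans (@le_normr_Rintegral _ _ _ mu _ _ mIx igx)).
have iag : mu.-integrable I (EFin \o (Num.Def.normr \o g))
  by exact: integrable_norm.
apply: fine_le.
- apply: integrable_fin_num; first exact: mIx.
  exact: (@integrableS _ _ _ mu _ _ _ mI mIx sIx iag).
- exact: (@integrable_fin_num _ _ _ mu _ mI _ iag).
apply: ge0_subset_integral => //.
- exact: (measurable_int _ iag).
Qed.

Lemma integral_from_inf_oriented x y : is_interval I -> I x -> I y -> x < y ->
  integral_from_inf I g y - integral_from_inf I g x = oriented_integral g x y.
Proof.
move=> itvI Ix Iy xy.
have iv : mu.-integrable setT (EFin \o (g \_ I)).
  by move: ig; rewrite integrable_mkcond//= restrict_EFin.
have ivS A : measurable A -> mu.-integrable A (EFin \o (g \_ I)).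
  by move=> mA; exact: integrableS iv.
rewrite !integral_from_infE /oriented_integral.
rewrite [X in _ = _ - X](_ : _ = 0) ?subr0; last first.
  by rewrite set_itv_ge ?Rintegral_set0// bnd_simp -ltNge.
have := @Rintegral_itvB _ (g \_ I) -oo%O (BRight y) x (ivS _ (measurable_itv _)).
rewrite !bnd_simp => /(_ isT (ltW xy)) ->.
rewrite Rintegral_itv_obnd_cbnd; last exact: ivS.
apply: eq_Rintegral => t; rewrite inE/= in_itv/= => /andP[xt ty].
rewrite patchE mem_set//.
by apply: (itvI x y) => //; rewrite xt ty.
Qed.

Lemma integral_from_inf_lipschitz (L : R) : is_interval I ->
  (forall x y, I x -> I y -> `|oriented_integral g x y| <= L * `|x - y|) ->
  forall x y, I x -> I y ->
  `|integral_from_inf I g x - integral_from_inf I g y| <= L * `|x - y|.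
Proof.
move=> itvI gL x y Ix Iy; have [xy|yx|->] := ltgtP x y.
- by rewrite distrC integral_from_inf_oriented//; exact: gL.
- by rewrite integral_from_inf_oriented// [X in _ * X]distrC; exact: gL.
- by rewrite !subrr normr0 mulr0.
Qed.

Variable nu : probability (measurableTypeR R) R.
Hypothesis nuI : nu (closure I) = 1%E.

Lemma measurable_closure_set : measurable (closure I : set (measurableTypeR R)).
Proof. exact: closed_measurable (@closed_closure _ I). Qed.

Let mray (t : R) : measurable ([set s | s <= t] : set (measurableTypeR R)).
Proof. by rewrite -set_itvNyc; exact: measurable_itv. Qed.

Let nuC : nu (~` closure I) = 0%E.
Proof. by rewrite probability_setC ?nuI ?subee//;
  exact: measurable_closure_set. Qed.

(** As [nu] is carried by the closure of [I], the points below [inf I] have mass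
    zero. *)
Lemma distribution_functionE (t : R) :
  distribution_function I nu t = fine (nu [set s | s <= t]).
Proof.
rewrite /distribution_function; congr fine.
set E := [set s : R | _ /\ _].
have mE : measurable (E : set (measurableTypeR R)).
  rewrite (_ : E = [set s | (ereal_inf [set x%:E | x in I] <= s%:E)%E] `&`
    [set s | s <= t])//; apply: measurableI => //.
  rewrite -[X in measurable X]setTI; apply: measurable_lee => //.
apply/eqP; rewrite eq_le; apply/andP; split.
  by apply: le_measure; rewrite ?inE// => s [].
apply: (@le_trans _ _ (nu (E `|` ~` closure I))).
  apply: le_measure; rewrite ?inE//.
    by apply: measurableU => //; apply: measurableC;
      exact: measurable_closure_set.
  move=> s st; have [cs|ncs] := pselect (closure I s); [left|by right].
  split => //; apply/lee_addgt0Pr => e e0.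
  have [x [Ix /= sx]] := cs _ (nbhsx_ballx s e e0).
  apply: (@le_trans _ _ x%:E); first by apply: ereal_inf_lbound; exists x.
  rewrite -EFinD lee_fin -lerBlDl ltW// (le_lt_trans _ sx)//.
  by rewrite distrC ler_norm.
apply: (le_trans (measureU2 _ _ _)) => //.
  by apply: measurableC; exact: measurable_closure_set.
by rewrite [X in (_ + X)%E]nuC adde0.
Qed.

Lemma distribution_function_compl (t : R) :
  (1 - distribution_function I nu t)%:E = nu [set s | t < s].
Proof.
rewrite distribution_functionE EFinB fineK ?fin_num_measure//.
rewrite (_ : [set s | t < s] = ~` [set s | s <= t]) ?probability_setC//.
by apply/seteqP; split => s /=; [move=> ts; apply/negP;
  rewrite -ltNge|move/negP; rewrite -ltNge].
Qed.

(** Fubini for [g t] on the set of pairs with [t < s].  The strict inequality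
    produces [nu [set s | t < s] = 1 - D t] exactly, and costs nothing on the
    other side, where points are Lebesgue null. *)
Lemma integral_primitive_nu :
  (\int[nu]_(s in closure I) (integral_from_inf I g s)%:E =
   \int[mu]_(t in I) (g t * (1 - distribution_function I nu t))%:E)%E.
Proof.
pose v := g \_ I.
have iv : mu.-integrable setT (EFin \o v).
  by move: ig; rewrite integrable_mkcond//= restrict_EFin.
have mv : measurable_fun [set: measurableTypeR R] v.
  by have := measurable_int _ iv; move/measurable_EFinP.
pose S : set (measurableTypeR R * measurableTypeR R) := [set z | z.1 < z.2].
have mS : measurable S.
  by apply: measurable_ltr_set; [exact: measurable_fst|exact: measurable_snd].
pose K : measurableTypeR R * measurableTypeR R -> R := fun z => v z.1 * \1_S z.
have mK : measurable_fun [set: measurableTypeR R * measurableTypeR R] (EFin \o K).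
  apply/measurable_EFinP; apply: measurable_funM; last exact: measurable_indic.
  exact: measurableT_comp mv measurable_fst.
have iK : (mu \x nu)%E.-integrable setT (EFin \o K).
  apply: (@integrable12ltyP _ _ _ _ R mu nu _ mK).2.
  have mabsK : measurable_fun [set: measurableTypeR R * measurableTypeR R]
      (fun z => `|(EFin \o K) z|%E) by exact: measurableT_comp.
  apply: (@le_lt_trans _ _ (\int[mu]_t `|(EFin \o v) t|)%E); last first.
    by have /integrableP[] := iv.
  apply: ge0_le_integral => //.
  - by move=> t _; exact: integral_ge0.
  - exact: (@measurable_fun_fubini_tonelli_F _ _ _ _ R nu _ mabsK
      (fun z => abse_ge0 _)).
  - by apply: measurableT_comp => //; exact: measurable_int iv.
  move=> t _.
  apply: (@le_trans _ _ (\int[nu]_s (cst `|v t|%:E) s)%E).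
    apply: ge0_le_integral => //.
    - exact: (measurableT_comp mabsK (pair1_measurable t)).
    - move=> s _ /=; rewrite lee_fin /K normrM ler_piMr// indicE.
      by case: (_ \in _); rewrite ?normr0 ?normr1.
  by rewrite integral_cst// [X in (_ * X)%E]probability_setT mule1.
have := Fubini iK.
have -> : (\int[mu]_t \int[nu]_s (EFin \o K) (t, s) =
    \int[mu]_(t in I) (g t * (1 - distribution_function I nu t))%:E)%E.
  rewrite [RHS]integral_mkcond; apply: eq_integral => t _.
  have mt : measurable ([set s | t < s] : set (measurableTypeR R)).
    by rewrite -set_itvoy; exact: measurable_itv.
  transitivity (\int[nu]_s ((v t)%:E * (\1_[set s | t < s] s)%:E))%E.
    apply: eq_integral => s _; rewrite /K /= EFinM !indicE.
    by rewrite (_ : ((t, s) \in S) = (s \in [set s | t < s]))//;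
      apply/idP/idP; rewrite !inE.
  rewrite integralZl//; last exact: integrable_indic.
  rewrite integral_indic// setIT.
  rewrite [X in (_ * X)%E](_ : _ = (1 - distribution_function I nu t)%:E);
    last first.
    by rewrite distribution_function_compl.
  rewrite /v !patchE.
  by case: ifPn => _; rewrite ?EFinM// mul0e.
have -> : (\int[nu]_s \int[mu]_t (EFin \o K) (t, s) =
    \int[nu]_(s in closure I) (integral_from_inf I g s)%:E)%E.
  have mG : measurable_fun setT (integral_from_inf I g).
    apply: continuous_measurable_fun; exact: continuous_integral_from_inf.
  transitivity (\int[nu]_s (integral_from_inf I g s)%:E)%E.
    apply: eq_integral => s _.
    transitivity (\int[mu]_(t in `]-oo, s[) (v t)%:E)%E.
      rewrite [RHS]integral_mkcond; apply: eq_integral => t _.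
      rewrite /K /= patchE indicE /S.
      have -> : ((t, s) \in [set z | z.1 < z.2]) = (t \in `]-oo, s[%classic).
        by apply/idP/idP; rewrite !inE/= ?in_itv.
      by case: ifPn => _; rewrite ?mulr1 ?mulr0.
    rewrite integral_itv_bndo_bndc; last first.
      by apply: measurable_funTS; exact: measurable_int iv.
    rewrite integral_from_infE /Rintegral fineK//.
    by apply: integrable_fin_num => //; exact: integrableS iv.
  rewrite [RHS]integral_mkcond; apply: ae_eq_integral => //.
  - exact/measurable_EFinP.
  - apply: (measurable_restrictT _ measurable_closure_set).1.
    by apply: measurable_funTS; exact/measurable_EFinP.
  exists (~` closure I); split; [|exact: nuC|].
  - by apply: measurableC; exact: measurable_closure_set.
  move=> s /= sn; apply: contra_not sn => cs _.
  by rewrite patchE mem_set.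
by move=> ->.
Qed.

End primitive.

(** * The Neumann series *)

Lemma lipschitz_measurable (R : realType) (I : set R) (u : R -> R) (K : R) :
  open I -> (forall a b, I a -> I b -> `|u a - u b| <= K * `|a - b|) ->
  measurable_fun I u.
Proof.
move=> oI uK; apply: open_continuous_measurable_fun => // x; rewrite inE => Ix.
apply/cvgrPdist_lt => e e0.
have K0 : 0 < `|K| + 1 by rewrite ltr_pwDr.
have nI : \forall y \near x, I y by exact: open_nbhs_nbhs.
near=> y.
have Iy : I y by near: y.
apply: (le_lt_trans (uK _ _ Ix Iy)).
apply: (@le_lt_trans _ _ ((`|K| + 1) * `|x - y|)).
  by rewrite ler_wpM2r// (le_trans (ler_norm K))// lerDl.
rewrite -ltr_pdivlMl// mulrC.
near: y; apply: cvgr_dist_lt; first exact: cvg_id.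
by rewrite divr_gt0.
Unshelve. all: by end_near. Qed.

Lemma normr_Rintegral_le (R : realType) (d : measure_display)
    (T : measurableType d) (P : {measure set T -> \bar R}) (f : T -> R) (c : R) :
  P.-integrable setT (EFin \o f) -> (\int[P]_w (`|f w|)%:E <= c%:E)%E ->
  `|\int[P]_w f w| <= c.
Proof.
move=> if_ fc; rewrite -lee_fin EFin_normr_Rintegral//.
apply: le_trans fc; apply: (le_trans (le_abse_integral _ _ _)) => //.
exact: measurable_int if_.
Qed.

Lemma lipschitz_abs_continuous (R : realType) (I : set R) (F : R -> R) (K : R) :
  0 < K -> (forall a b, I a -> I b -> `|F a - F b| <= K * `|a - b|) ->
  abs_continuous_on I F.
Proof.
move=> K0 FK e e0; exists (e / K); first by rewrite divr_gt0.
move=> n a b ab _; rewrite ltr_pdivlMr// => sab.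
apply: le_lt_trans sab; rewrite mulr_suml; apply: ler_sum => i _.
have [Ia Ib lt_ab] := ab i.
by apply: (le_trans (FK _ _ Ib Ia)); rewrite mulrC gtr0_norm ?subr_gt0.
Qed.

Section contraction.
Variables (R : realType) (d : measure_display) (Omega : measurableType d).
Variables (P : probability Omega R) (I : set R) (phi : R -> Omega -> R).
Notation mu := (@lebesgue_measure R).
Hypotheses (oI : open I).
Hypothesis phi_diffeo : forall w, diffeomorphism_onto I (phi ^~ w).
Hypothesis phi_meas : forall x, I x ->
  measurable_fun [set: Omega] (phi x : Omega -> measurableTypeR R).
Let mI : measurable I. Proof. exact: open_measurable. Qed.

Variable l : R.
Hypothesis l_itv : 0 < l < 1.
Hypothesis phi_moment : forall x, I x ->
  (\int[P]_w (`|phi x w - x|)%:E < +oo)%E.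
Hypothesis phi_contr : forall x y, I x -> I y ->
  (\int[P]_w (`|phi x w - phi y w|)%:E <= (l * `|x - y|)%:E)%E.

Lemma transition_lipschitz (u : R -> R) (M K : R) : 0 <= K ->
  measurable_fun I u -> (forall y, I y -> `|u y| <= M) ->
  (forall a b, I a -> I b -> `|u a - u b| <= K * `|a - b|) ->
  forall a b, I a -> I b ->
  `|transition P phi u a - transition P phi u b| <= K * l * `|a - b|.
Proof.
move=> K0 mu_ uM uK a b Ia Ib.
have ia := transition_integrable P oI phi_diffeo phi_meas mu_ uM Ia.
have ib := transition_integrable P oI phi_diffeo phi_meas mu_ uM Ib.
rewrite /transition -RintegralB//; apply: normr_Rintegral_le.
  exact: integrable_EFinB.
apply: (@le_trans _ _ (\int[P]_w (K%:E * (`|phi a w - phi b w|)%:E))%E).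
  apply: ge0_le_integral => //.
  - apply/measurable_EFinP; apply: measurableT_comp => //.
    by apply: measurable_funB;
      exact: (measurable_comp_phi oI phi_diffeo phi_meas).
  - apply: measurable_funeM; apply/measurable_EFinP;
      apply: measurableT_comp => //.
    by apply: measurable_funB; exact: phi_meas.
  - by move=> w _; rewrite -EFinM lee_fin uK//; exact: (diffeo_phi phi_diffeo).
rewrite ge0_integralZl//; last first.
  apply/measurable_EFinP; apply: measurableT_comp => //.
  by apply: measurable_funB; exact: phi_meas.
rewrite -mulrA EFinM; apply: lee_wpmul2l; first by rewrite lee_fin.
exact: phi_contr.
Qed.

Definition drift (x : R) : R := \int[P]_w `|phi x w - x|.

(** The Lipschitz bound for [u] between [x] and [phi x w], averaged over [w]. *)
Lemma transition_drift (u : R -> R) (M K : R) : 0 <= K ->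
  measurable_fun I u -> (forall y, I y -> `|u y| <= M) ->
  (forall a b, I a -> I b -> `|u a - u b| <= K * `|a - b|) ->
  forall x, I x -> `|transition P phi u x - u x| <= K * drift x.
Proof.
move=> K0 mu_ uM uK x Ix.
have ix := transition_integrable P oI phi_diffeo phi_meas mu_ uM Ix.
have ic : P.-integrable setT (EFin \o cst (u x))
  by exact: finite_measure_integrable_cst.
have -> : transition P phi u x - u x = \int[P]_w (u (phi x w) - u x).
  rewrite RintegralB// Rintegral_cst// /transition; congr (_ - _).
  by rewrite [X in fine X]probability_setT mulr1.
apply: normr_Rintegral_le; first exact: integrable_EFinB.
apply: (@le_trans _ _ (\int[P]_w (K%:E * (`|phi x w - x|)%:E))%E).
  apply: ge0_le_integral => //.
  - apply/measurable_EFinP; apply: measurableT_comp => //.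
    apply: measurable_funB => //;
      exact: (measurable_comp_phi oI phi_diffeo phi_meas).
  - apply: measurable_funeM; apply/measurable_EFinP;
      apply: measurableT_comp => //.
    by apply: measurable_funB => //; exact: phi_meas.
  - by move=> w _; rewrite -EFinM lee_fin uK//; exact: (diffeo_phi phi_diffeo).
rewrite ge0_integralZl//; last first.
  apply/measurable_EFinP; apply: measurableT_comp => //.
  by apply: measurable_funB => //; exact: phi_meas.
rewrite EFinM; apply: lee_wpmul2l; first by rewrite lee_fin.
rewrite /drift /Rintegral fineK// ge0_fin_numE ?phi_moment//.
by apply: integral_ge0.
Qed.

Section neumann_series.
Variables (u0 : R -> R) (M L : R).
Hypotheses (L0 : 0 < L) (u0M : forall y, I y -> `|u0 y| <= M).
Hypothesis u0L : forall a b, I a -> I b -> `|u0 a - u0 b| <= L * `|a - b|.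

Let l0 : 0 < l. Proof. by case/andP: l_itv. Qed.
Let l1 : l < 1. Proof. by case/andP: l_itv. Qed.
Let l1' : 0 < 1 - l. Proof. by rewrite subr_gt0. Qed.

Definition iterate (n : nat) : R -> R := iter n (transition P phi) u0.

Lemma iterate_lipschitz_bounded n :
  (forall a b, I a -> I b -> `|iterate n a - iterate n b| <= L * l ^+ n * `|a - b|) /\
  (forall y, I y -> `|iterate n y| <= M).
Proof.
elim: n => [|n [IHL IHM]]; first by rewrite expr0 mulr1.
have mun := lipschitz_measurable oI IHL.
split; last first.
  by move=> y Iy; exact: (transition_bounded P oI phi_diffeo phi_meas mun IHM Iy).
move=> a b Ia Ib; rewrite exprSr mulrA.
apply: (transition_lipschitz _ mun IHM IHL) => //.
by rewrite mulr_ge0 ?exprn_ge0// ltW.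
Qed.

Lemma iterate_measurable n : measurable_fun I (iterate n).
Proof. exact: lipschitz_measurable oI (iterate_lipschitz_bounded n).1. Qed.

Lemma iterate_drift n x : I x ->
  `|iterate n.+1 x - iterate n x| <= L * l ^+ n * drift x.
Proof.
move=> Ix; have [uL uM] := iterate_lipschitz_bounded n.
apply: (transition_drift _ (iterate_measurable n) uM uL) => //.
by rewrite mulr_ge0 ?exprn_ge0// ltW.
Qed.

Lemma drift_ge0 x : 0 <= drift x.
Proof. exact: Rintegral_ge0. Qed.

Hypothesis iterate0 : forall x, I x -> iterate n x @[n --> \oo] --> 0.

(** Telescoping [iterate_drift] from [n] to [p + n] and letting [p] tend to
    infinity, where [iterate0] removes the last term. *)
Lemma iterate_geometric n x : I x ->
  `|iterate n x| <= L * drift x / (1 - l) * l ^+ n.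
Proof.
move=> Ix; set C := _ / (1 - l).
have C0 : 0 <= C by rewrite /C divr_ge0 ?mulr_ge0 ?drift_ge0// ltW.
(* the partial geometric sum L * drift x * l ^+ n * (1 + ... + l ^+ p.-1) *)
have step p : `|iterate n x| <= `|iterate (p + n) x| + C * l ^+ n * (1 - l ^+ p).
  elim: p => [|p IHp]; first by rewrite add0n expr0 subrr mulr0 addr0.
  apply: (le_trans IHp); rewrite addSn.
  have := iterate_drift (p + n) Ix; rewrite exprD => h.
  have E : C * (1 - l) = L * drift x by rewrite /C divfK// gt_eqF.
  have t : `|iterate (p + n) x| <=
      `|iterate (p + n).+1 x| + `|iterate (p + n).+1 x - iterate (p + n) x|.
    by rewrite [X in _ + X]distrC -lerBlDl; exact: lerB_dist.
  apply: (le_trans (lerD t (lexx _))); rewrite -addrA lerD2l.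
  apply: (le_trans (lerD h (lexx _))).
  rewrite exprSr -subr_ge0.
  rewrite (_ : _ - _ = (C * (1 - l) - L * drift x) * (l ^+ p * l ^+ n));
    last by ring.
  by rewrite E subrr mul0r.
have step' p : `|iterate n x| <= `|iterate (p + n) x| + C * l ^+ n.
  apply: (le_trans (step p)); rewrite lerD2l ler_piMr//.
    by rewrite mulr_ge0 ?exprn_ge0// ltW.
  by rewrite gerBl exprn_ge0// ltW.
have : `|iterate (p + n) x| + C * l ^+ n @[p --> \oo] --> `|(0 : R)| + C * l ^+ n.
  apply: cvgD; last exact: cvg_cst.
  apply: cvg_norm; rewrite (cvg_shiftn n (iterate ^~ x)); exact: iterate0.
rewrite normr0 add0r => /cvgr_to_ge; apply.
by apply: nearW => p.
Qed.

Definition neumann (x : R) : R := limn (series (iterate ^~ x)).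

Lemma cvg_neumann x : I x -> series (iterate ^~ x) n @[n --> \oo] --> neumann x.
Proof.
move=> Ix; apply: normed_cvg; set C := L * drift x / (1 - l).
apply: (series_le_cvg (v_ := geometric C l)).
- by move=> n /=.
- move=> n /=; rewrite mulr_ge0 ?exprn_ge0//; last exact: ltW.
  by rewrite /C divr_ge0 ?mulr_ge0 ?drift_ge0// ltW.
- by move=> n /=; exact: iterate_geometric.
- by apply: is_cvg_geometric_series; rewrite gtr0_norm.
Qed.

Let K := L / (1 - l).
Let K0 : 0 < K. Proof. by rewrite divr_gt0. Qed.

Lemma series_lipschitz n a b : I a -> I b ->
  `|series (iterate ^~ a) n - series (iterate ^~ b) n| <= K * `|a - b|.
Proof.
move=> Ia Ib; rewrite /series/= -sumrB.
apply: (le_trans (ler_norm_sum _ _ _)).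
apply: (@le_trans _ _ (\sum_(0 <= k < n) (L * `|a - b|) * l ^+ k)).
  by apply: ler_sum => k _; rewrite mulrAC;
    exact: (iterate_lipschitz_bounded k).1.
have /le_trans : series (geometric (L * `|a - b|) l) n <= (L * `|a - b|) * (1 - l)^-1.
  apply: geometric_le_lim => //; last by rewrite gtr0_norm.
  by rewrite mulr_ge0// ltW.
by apply; rewrite /K mulrAC.
Qed.

Lemma neumann_lipschitz a b : I a -> I b ->
  `|neumann a - neumann b| <= K * `|a - b|.
Proof.
move=> Ia Ib.
have : `|series (iterate ^~ a) n - series (iterate ^~ b) n| @[n --> \oo] -->
    `|neumann a - neumann b|.
  by apply: cvg_norm; apply: cvgB; exact: cvg_neumann.
move/cvgr_to_le; apply; apply: nearW => n; exact: series_lipschitz.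
Qed.

Let integrable_iterate n x : I x ->
  P.-integrable setT (EFin \o (fun w => iterate n (phi x w))).
Proof.
move=> Ix.
exact: (transition_integrable P oI phi_diffeo phi_meas (iterate_measurable n)
  (iterate_lipschitz_bounded n).2 Ix).
Qed.

Let integrable_series n x : I x ->
  P.-integrable setT (EFin \o (fun w => series (iterate ^~ (phi x w)) n)).
Proof.
move=> Ix; elim: n => [|n IHn].
  apply: (eq_integrable measurableT (cst 0%E)) => //; last exact: integrable0.
  by move=> w _; rewrite /= /series/= big_nil.
have := @integrableD _ _ _ P _ measurableT _ _ IHn (integrable_iterate n Ix).
apply: eq_integrable => // w _.
by rewrite /= -EFinD /series/= big_nat_recr.
Qed.

Lemma series_transition n x : I x ->
  \int[P]_w series (iterate ^~ (phi x w)) n = series (iterate ^~ x) n.+1 - u0 x.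
Proof.
move=> Ix; elim: n => [|n IHn].
  rewrite /series/= big_nat1 subrr.
  by under eq_Rintegral do rewrite big_nil; rewrite Rintegral_cst// mul0r.
rewrite [in RHS]/series/= big_nat_recr//= -/(series (iterate ^~ x) n.+1).
rewrite addrAC -IHn -[X in _ + X]/(\int[P]_w iterate n (phi x w)).
rewrite -RintegralD//.
- by apply: eq_Rintegral => w _; rewrite /series/= big_nat_recr.
- exact: integrable_series.
- exact: integrable_iterate.
Qed.

(** Pass to the limit in [series_transition].  The partial sums at [phi x w] are
    dominated because they are bounded at [x] and Lipschitz with a constant
    independent of [n]. *)
Lemma neumann_fixpoint x : I x ->
  P.-integrable setT (fun w => (neumann (phi x w))%:E) /\
  neumann x = \int[P]_w neumann (phi x w) + u0 x.
Proof.
move=> Ix.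
have scvg := cvg_neumann Ix.
have [B [Breal SB]] := cvg_seq_bounded (cvgP _ scvg).
have {}SB n : `|series (iterate ^~ x) n| <= B + 1 by apply: SB; rewrite ?ltrDl.
(* B + 1 bounds the partial sums at x, and K is their Lipschitz constant *)
pose dom w := (B + 1) + K * `|phi x w - x|.
have mdist : measurable_fun setT (fun w => `|phi x w - x|).
  apply: measurableT_comp => //; apply: measurable_funB => //; exact: phi_meas.
have idist : P.-integrable setT (EFin \o (fun w => `|phi x w - x|)).
  apply/integrableP; split; first exact/measurable_EFinP.
  by under eq_integral do rewrite /= normr_id; exact: phi_moment.
have idom : P.-integrable setT (EFin \o dom).
  have := @integrableD _ _ _ P _ measurableT _ _
    (finite_measure_integrable_cst P (B + 1) measurableT)
    (integrableZl measurableT K idist).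
  by apply: eq_integrable.
pose S_ n w := (series (iterate ^~ (phi x w)) n)%:E.
have mser n : measurable_fun setT (S_ n).
  exact: measurable_int (integrable_series n Ix).
have cser w : S_ n w @[n --> \oo] --> (neumann (phi x w))%:E.
  apply: cvg_EFin; first exact: nearW.
  by apply: cvg_neumann; exact: (diffeo_phi phi_diffeo).
have mF : measurable_fun setT (fun w => (neumann (phi x w))%:E).
  by apply: (@emeasurable_fun_cvg _ _ _ _ S_) => // w _; exact: cser.
have dom_ge n w : (`|S_ n w| <= (dom w)%:E)%E.
  rewrite /S_ lee_fin /dom addrC -lerBlDr.
  apply: (@le_trans _ _ (`|series (iterate ^~ (phi x w)) n| - `|series (iterate ^~ x) n|)).
    by rewrite lerD2l lerN2.
  apply: (le_trans (lerB_dist _ _)); apply: series_lipschitz => //.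
  exact: (diffeo_phi phi_diffeo).
have [iF _ cint] := @dominated_convergence _ _ _ P setT measurableT S_ _ (EFin \o dom)
  mser mF (aeW _ (fun w _ => cser w)) idom (aeW _ (fun w n _ => dom_ge n w)).
split => //.
have c1 : \int[P]_w series (iterate ^~ (phi x w)) n @[n --> \oo] --> \int[P]_w neumann (phi x w).
  apply: fine_cvg; rewrite /Rintegral fineK//.
  exact: integrable_fin_num.
have c2 : series (iterate ^~ x) n.+1 - u0 x @[n --> \oo] --> neumann x - u0 x.
  apply: cvgB; last exact: cvg_cst.
  by rewrite (cvg_shiftS (series (iterate ^~ x))).
have -> : \int[P]_w neumann (phi x w) = neumann x - u0 x.
  apply: (cvg_unique _ c1) => //.
  rewrite (_ : (fun n => _) = fun n => series (iterate ^~ x) n.+1 - u0 x)//.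
  by apply/funext => n; exact: series_transition.
by rewrite subrK.
Qed.

End neumann_series.

End contraction.

(** * Convergence of the iterates and the theorem *)

Section weak_limit.
Variables (R : realType) (d : measure_display) (Omega : measurableType d).
Variables (P : probability Omega R) (Pinf : probability (Omega_seq Omega) R).
Variables (I : set R) (phi : R -> Omega -> R).
Hypothesis oI : open I.
Hypothesis phi_diffeo : forall w, diffeomorphism_onto I (phi ^~ w).
Hypothesis phi_meas : forall x, I x ->
  measurable_fun [set: Omega] (phi x : Omega -> measurableTypeR R).
Hypothesis Pinf_prod : is_product_probability P Pinf.

(** Each application of [integral_phi0_iterS] trades one step of the random walk
    for one application of the operator. *)
Lemma iterate_expectation (u : R -> R) (M : R) n x :
  (forall k, measurable_fun I (iterate P phi u k)) ->
  (forall k y, I y -> `|iterate P phi u k y| <= M) -> I x ->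
  (iterate P phi u n x)%:E = (\int[Pinf]_w (u (phi0_iter I phi n x w))%:E)%E.
Proof.
move=> mu_ uM Ix.
suff /(_ n 0%N) <- : forall m k,
    (\int[Pinf]_w (iterate P phi u k (phi0_iter I phi m x w))%:E =
     (iterate P phi u (k + m) x)%:E)%E by [].
elim => [|m IHm] k.
  rewrite addn0 /= integral_cst// [X in (_ * X)%E]probability_setT.
  by rewrite mule1.
rewrite (integral_phi0_iterS oI phi_diffeo phi_meas Pinf_prod m (mu_ k) (uM k) Ix).
by rewrite addnS -addSn -IHm.
Qed.

Lemma iterate_cvg (nu : set (measurableTypeR R) -> \bar R) (u : R -> R) (M : R) x :
  weakly_converges_on (closure I) (fun n => iter_law I phi Pinf n x) nu ->
  continuous u -> (forall y, `|u y| <= M) ->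
  (forall k, measurable_fun I (iterate P phi u k)) ->
  (forall k y, I y -> `|iterate P phi u k y| <= M) -> I x ->
  (iterate P phi u n x)%:E @[n --> \oo] --> (\int[nu]_(y in closure I) (u y)%:E)%E.
Proof.
move=> wcvg cu uM' mu_ uM Ix.
have := wcvg u (continuous_subspaceT cu) (ex_intro _ M (fun y _ => uM' y)).
apply: cvg_trans; apply: near_eq_cvg; apply: nearW => n /=.
rewrite (iterate_expectation _ mu_ uM Ix) /iter_law.
have mX := phi0_iter_measurable oI phi_diffeo phi_meas n Ix.
have muu : measurable_fun [set: measurableTypeR R] u
  by exact: continuous_measurable_fun.
have pre : (phi0_iter I phi n x : Omega_seq Omega -> measurableTypeR R) @^-1` closure I = setT.
  apply/seteqP; split => // w _; apply: subset_closure.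
  exact: phi0_iter_in.
rewrite (@integral_pushforward _ _ (Omega_seq Omega) (measurableTypeR R) R _ mX Pinf).
- by rewrite pre.
- exact/measurable_EFinP.
- rewrite pre; apply: (@bounded_integrable _ _ _ Pinf _ M) => //.
    by rewrite -ge0_fin_numE// fin_num_measure.
  exact: measurableT_comp muu mX.
- exact: closed_measurable (@closed_closure _ I).
Qed.

End weak_limit.

Theorem theorem5p2 (R : realType) (d : measure_display)
    (Omega : measurableType d) (P : probability Omega R)
    (I : set R) (g : R -> R) (phi : R -> Omega -> R)
    (x0 l L alpha : R)
    (Pinf : probability (Omega_seq Omega) R)
    (nu : probability (measurableTypeR R) R)
    (P_complete : measure_is_complete P)
    (I_itv : is_interval I) (I_open : open I) (I_x0 : I x0)
    (g_L1 : (@lebesgue_measure R).-integrable I (EFin \o g))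
    (phi_diffeo : forall w, diffeomorphism_onto I (phi ^~ w))
    (phi_meas : forall x, I x ->
      measurable_fun [set: Omega] (phi x : Omega -> measurableTypeR R))
    (phi_nonsingular : nonsingular P I phi)
    (P_plus : P (Omega_plus phi x0) = 1%E)
    (phi_moment : forall x, I x ->
      (\int[P]_w (`|phi x w - x|)%:E < +oo)%E)
    (l_itv : 0 < l < 1)
    (phi_contr : forall x y, I x -> I y ->
      (\int[P]_w (`|phi x w - phi y w|)%:E <= (l * `|x - y|)%:E)%E)
    (Pinf_prod : is_product_probability P Pinf)
    (nu_limit : limit_distribution I phi Pinf nu)
    (g_orth : \int[@lebesgue_measure R]_(t in I)
                (g t * (1 - distribution_function I nu t)) = 0)
    (L_gt0 : 0 < L)
    (g_lip : forall x y, I x -> I y ->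
      `|oriented_integral g x y| <= L * `|x - y|) :
  (exists2 F : R -> R, abs_continuous_on I F &
     integrated_solution P I phi x0 alpha g F) /\
  (forall F : R -> R, abs_continuous_on I F ->
     integrated_solution P I phi x0 alpha g F ->
     forall f : R -> R,
       (@lebesgue_measure R).-integrable I (EFin \o f) ->
       (forall x, I x -> F x = integral_from_inf I f x) ->
       L1_solution P I phi g f).
Proof.
have mI := open_measurable I_open.
split; last first.
  move=> F _ Fsol f if_ Ff.
  exact: (L1_solution_of_antiderivative I_itv I_open I_x0 phi_diffeo phi_meas
    P_plus P_complete phi_nonsingular g_L1 Fsol if_ Ff).
pose G := integral_from_inf I g.
have GL := integral_from_inf_lipschitz mI g_L1 I_itv g_lip.
have GM y : `|G y| <= _ := integral_from_inf_bounded mI g_L1 y.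
have [nuI nu_weak] := nu_limit.
have G_lipb := iterate_lipschitz_bounded I_open phi_diffeo phi_meas l_itv phi_contr
  L_gt0 (fun y _ => GM y) GL.
have G_meas n := lipschitz_measurable I_open (G_lipb n).1.
have nu0 : (\int[nu]_(y in closure I) (G y)%:E = 0)%E.
  have mG : measurable_fun [set: measurableTypeR R] G.
    apply: continuous_measurable_fun.
    exact: continuous_integral_from_inf mI g_L1.
  have mcI := @measurable_closure_set R I.
  have iG : nu.-integrable (closure I) (EFin \o G).
    apply: (integrableS measurableT mcI) => //.
    apply: (bounded_integrable _ mG GM).
    by rewrite -ge0_fin_numE// fin_num_measure.
  rewrite -(fineK (integrable_fin_num mcI iG)) (integral_primitive_nu mI g_L1 nuI).
  by congr EFin.
have iter0 x : I x -> iterate P phi G n x @[n --> \oo] --> 0.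
  move=> Ix; have cIx : closure I x by exact: subset_closure.
  have := iterate_cvg I_open phi_diffeo phi_meas Pinf_prod (nu_weak x cIx)
    (continuous_integral_from_inf mI g_L1) GM G_meas (fun k => (G_lipb k).2) Ix.
  by rewrite nu0 => /fine_cvg.
exists (neumann P phi G).
  apply: (@lipschitz_abs_continuous _ _ _ (L / (1 - l))).
    by rewrite divr_gt0// subr_gt0; case/andP: l_itv.
  exact: (neumann_lipschitz I_open phi_diffeo phi_meas l_itv phi_moment phi_contr
    L_gt0 (fun y _ => GM y) GL iter0).
move=> x Ix.
have [iF EF] := neumann_fixpoint I_open phi_diffeo phi_meas l_itv phi_moment phi_contr
  L_gt0 (fun y _ => GM y) GL iter0 Ix.
have mOp := measurable_Omega_plus I_open I_x0 phi_diffeo phi_meas.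
have mOm := measurable_Omega_minus I_open I_x0 phi_diffeo phi_meas.
have Om0 := Omega_minus0 I_open I_x0 phi_diffeo phi_meas P_plus.
have mF : measurable_fun setT (fun w => neumann P phi G (phi x w)).
  by have := measurable_int _ iF; move/measurable_EFinP.
have mFm : measurable_fun (Omega_minus phi x0)
    (fun w => (alpha - neumann P phi G (phi x w))%:E).
  by apply/measurable_EFinP; apply: measurable_funTS; exact: measurable_funB.
split.
- exact: (integrableS measurableT mOp (@subsetT _ _) iF).
- exact: null_set_integrable.
rewrite [X in _ = _ + X + _](_ : _ = 0) ?addr0; last first.
  by rewrite /Rintegral null_set_integral.
rewrite EF; congr (_ + _).
rewrite /Rintegral (integral_Omega_plus I_open I_x0 phi_diffeo phi_meas P_plus)//.
exact/measurable_EFinP.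
Qed.
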